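(* Let $\alpha>0$, $(a,b)\in\mathbb{R}^2$ with $a<b$, and $f\in S_a^\alpha(L^1)$. Then $$S_a^\alpha\left(\mathcal{D}_a^\alpha f\right)(x)=f(x),\quad \text{for a.e. } x\in[a,b].$$
   Context: Let $E_1(x)=\int_x^\infty \frac{e^{-t}}{t}\,dt$ for $x>0$ and $\mathcal{S}(t)=e^{-t}\int_0^\infty \frac{t^{s-1}}{\Gamma(s)}\,ds$ for $t>0$, where $\Gamma$ is the Gamma function. For $\alpha>0$ and $f\in L^1([a,b];\mathbb{R})$, define for a.e. $x\in[a,b]$ $$(J_a^\alpha f)(x)=\frac{1}{\alpha}\int_a^x E_1\left(\frac{x-t}{\alpha}\right)f(t)\,dt,\qquad (S_a^\alpha f)(x)=\int_a^x \mathcal{S}\left(\frac{x-t}{\alpha}\right)f(t)\,dt.$$ A function in $L^1([a,b];\mathbb{R})$ has an absolutely continuous representative if it coincides a.e. on $[a,b]$ with an absolutely continuous function on $[a,b]$; it is then identified with that function. If $J_a^\alpha f$ has an absolutely continuous representative, the left-sided fractional derivative of order $\alpha$ of $f$ is $(\mathcal{D}_a^\alpha f)(x)=\frac{d}{dx}(J_a^\alpha f)(x)$ for a.e. $x\in[a,b]$. The space $S_a^\alpha(L^1)$ is $\{S_a^\alpha\varphi:\ \varphi\in L^1([a,b];\mathbb{R})\}$. *)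

(* Defs.v *)
From HB Require Import structures.
From mathcomp Require Import all_boot all_order all_algebra.
From mathcomp Require Import all_classical all_reals all_analysis.

Set Implicit Arguments.
Unset Strict Implicit.
Unset Printing Implicit Defensive.

Import Order.TTheory GRing.Theory Num.Theory.
Import numFieldNormedType.Exports.

Local Open Scope classical_set_scope.
Local Open Scope ring_scope.

Section special_functions.
Context {R : realType}.
Local Notation mu := (@lebesgue_measure R).

                                                                            

Definition Gamma (s : R) : R :=
  \int[mu]_(t in `]0, +oo[) (t `^ (s - 1) * expR (- t)).

Definition expint1 (x : R) : R :=
  \int[mu]_(t in `[x, +oo[) (expR (- t) / t).

Definition sonine_kernel (t : R) : R :=
  expR (- t) * \int[mu]_(s in `]0, +oo[) (t `^ (s - 1) / Gamma s).

End special_functions.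

Section fractional_calculus.
Context {R : realType}.
Local Notation mu := (@lebesgue_measure R).

                                                                              
                                                                       
                         
Definition L1 (a b : R) (f : R -> R) : Prop :=
  mu.-integrable `[a, b] (EFin \o f).

Definition frac_J (a alpha : R) (f : R -> R) (x : R) : R :=
  alpha^-1 * \int[mu]_(t in `[a, x]) (expint1 ((x - t) / alpha) * f t).

Definition frac_S (a alpha : R) (f : R -> R) (x : R) : R :=
  \int[mu]_(t in `[a, x]) (sonine_kernel ((x - t) / alpha) * f t).

Definition in_frac_S_L1 (a b alpha : R) (f : R -> R) : Prop :=
  L1 a b f /\
  exists2 phi : R -> R, L1 a b phi & ae_eq mu `[a, b]%classic f (frac_S a alpha phi).

                                                                              
                            
Definition absolutely_continuous (a b : R) (g : R -> R) : Prop :=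
  forall e : R, 0 < e -> exists2 d : R, 0 < d &
    forall (n : nat) (l r : 'I_n -> R),
      (forall i, a <= l i /\ l i <= r i /\ r i <= b) ->
      trivIset [set: 'I_n] (fun i => [set` `]l i, r i[]) ->
      \sum_(i < n) (r i - l i) < d ->
      \sum_(i < n) `|g (r i) - g (l i)| < e.

Definition ac_representative (a b : R) (u g : R -> R) : Prop :=
  absolutely_continuous a b g /\ ae_eq mu `[a, b]%classic u g.

Definition has_ac_representative (a b : R) (u : R -> R) : Prop :=
  exists g : R -> R, ac_representative a b u g.

                                                                             
                                                                            
Definition the_ac_representative (a b : R) (u : R -> R) : R -> R :=
  xget u [set g | ac_representative a b u g].

                                                                   
                     
Definition frac_deriv (a b alpha : R) (f : R -> R) : R -> R :=
  derive1 (the_ac_representative a b (frac_J a alpha f)).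

End fractional_calculus.

(* Main.v *)
(** Write [g_s(t) = t^(s-1) e^(-t) / Gamma(s)] for the Gamma densities, so that
    the Sonine kernel is [S = int_0^oo g_s ds], and [H] for the Heaviside
    function.  Since [g_r * g_s = g_(r+s)], convolving [g_s] with the tail
    [U_r(y) = int_y^oo t^(r-1) e^(-t) dt] gives the telescoping identity
    [U_r * g_s = Gamma(r) (H * g_s - H * g_(r+s))]; integrating over [s] leaves
    [U_r * S = Gamma(r) int_0^r (H * g_s) ds].  As [r -> 0] the left-hand side
    tends to [E_1 * S] and the right-hand side to 1, whence Sonine's identity
    [E_1 * S = 1] on the positive half-line.  By Fubini, [J (S phi)] is then the
    primitive of [phi], which is absolutely continuous with derivative [phi]
    almost everywhere, so that [S (D f) = S phi = f]. *)

Require Import Defs.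
From HB Require Import structures.
From mathcomp Require Import all_boot all_order all_algebra.
From mathcomp Require Import all_classical all_reals all_analysis.
From mathcomp Require Import measurable_realfun ring lra.

Set Implicit Arguments.
Unset Strict Implicit.
Unset Printing Implicit Defensive.

Import Order.TTheory GRing.Theory Num.Theory.
Import numFieldNormedType.Exports.

Local Open Scope classical_set_scope.
Local Open Scope ring_scope.

(** * Convolution of nonnegative functions *)

Section affine_substitution.
Context {R : realType}.
Local Notation mu := (@lebesgue_measure R).
Local Open Scope ereal_scope.

(** The delicate point is the cancellation behind the telescoping. The integral over s of H * g_s
    might a priori be infinite, and subtracting its shifted copy would then be meaningless.
    Identities are therefore kept in additive form over the extended reals, where Tonelli applies to
    nonnegative kernels without integrability, and finiteness is proved separately by a renewal-type
    bound. The parameter r > 0 regularises E_1 = U_0, at which the factor Gamma(r) would diverge.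
    The limit r -> 0 is taken through explicit inequalities linear in r instead of a convergence
    theorem: t^r <= 1 + r t, then t^r >= d^r for t >= d, and r Gamma(r) <= 1 + r. Sonine's identity
    also supplies the integrability that Fubini requires, since it evaluates the integral of the
    absolute value. Two obstacles come from the real-valued statement: S and S phi are only
    controlled almost everywhere, because an infinite integral is read as 0, and the derivative of
    the chosen representative must be shown to be Borel measurable, which its agreement with phi
    almost everywhere does not give. *)

Lemma measurable_affine (c d : R) :
  measurable_fun [set: R] (fun x : R => c * x + d)%R.
Proof. exact: measurable_funD. Qed.

Section affine_pushforward.
Variables (c d : R).
Hypothesis c0 : (0 < c)%R.

Let maff : @measurable_fun _ _ (measurableTypeR R) (measurableTypeR R) setT
  (fun x : R => c * x + d)%R.
Proof. exact: measurable_affine. Qed.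
Let push : {measure set (measurableTypeR R) -> \bar R} :=
  measure_function_pushforward__canonical__measure_function_Measure
    mu maff.
Let scaled : {measure set (measurableTypeR R) -> \bar R} :=
  mscale (NngNum (ltW c0)) push.

(** Lebesgue measure is determined by its values on half-open intervals, whose preimages are again
    half-open intervals, shorter by the factor c. *)
Let lebesgue_scaled (A : set R) : measurable A -> mu A = scaled A.
Proof.
move=> mA; apply: (lebesgue_measure_unique (mu := scaled)) => //= _ [[p q]] _ <-.
rewrite /mscale/= /pushforward.
have -> : (fun x : R => (c * x + d)%R) @^-1` `]p, q]%classic =
    `]((p - d) / c)%R, ((q - d) / c)%R]%classic.
  by apply/seteqP; split => x /=; rewrite !in_itv/= ltr_pdivrMr// ler_pdivlMr//
    ltrBlDr lerBrDr (mulrC x).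
rewrite !lebesgue_measure_itv/= !lte_fin ltr_pM2r ?invr_gt0// ltrD2r.
case: ifP => pq; last by rewrite mule0.
by rewrite -!EFinB -EFinM; congr EFin; field; rewrite gt_eqF.
Qed.

Lemma ge0_integral_affine (f : R -> \bar R) :
  measurable_fun [set: R] f -> (forall x, 0 <= f x) ->
  \int[mu]_x f x = c%:E * \int[mu]_x f (c * x + d)%R.
Proof.
move=> mf f0.
transitivity (\int[scaled]_x f x).
  by apply: eq_measure_integral => A mA _; exact: lebesgue_scaled.
rewrite ge0_integral_mscale//; congr (_ * _).
exact: (ge0_integral_pushforward maff mu measurableT mf (fun x _ => f0 x)).
Qed.

End affine_pushforward.

Lemma ge0_integral_shift (f : R -> \bar R) (d : R) :
  measurable_fun [set: R] f -> (forall x, 0 <= f x) ->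
  \int[mu]_x f (x + d)%R = \int[mu]_x f x.
Proof.
move=> mf f0; rewrite (@ge0_integral_affine 1 d ltr01 f)// mul1e.
by under [RHS]eq_integral do rewrite mul1r.
Qed.

Lemma ge0_integral_dilate (f : R -> \bar R) (c : R) : (0 < c)%R ->
  measurable_fun [set: R] f -> (forall x, 0 <= f x) ->
  c%:E * \int[mu]_x f (c * x)%R = \int[mu]_x f x.
Proof.
move=> c0 mf f0; rewrite [RHS](@ge0_integral_affine c 0 c0 f)//.
by under [in RHS]eq_integral do rewrite addr0.
Qed.

End affine_substitution.

Section convolution.
Context {R : realType}.
Local Notation mu := (@lebesgue_measure R).
Local Open Scope ereal_scope.
Implicit Types f g h : R -> \bar R.

Definition econv f g (x : R) := \int[mu]_u (f (x - u)%R * g u).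

Lemma econv_ge0 f g x : (forall x, 0 <= f x) -> (forall x, 0 <= g x) ->
  0 <= econv f g x.
Proof. by move=> f0 g0; apply: integral_ge0 => u _; exact: mule_ge0. Qed.

Lemma measurable_sub2 :
  measurable_fun [set: R * R] (fun z : R * R => (z.1 - z.2)%R).
Proof. exact: measurable_funB. Qed.

Lemma measurable_conv_integrand f g : measurable_fun [set: R] f ->
  measurable_fun [set: R] g ->
  measurable_fun [set: R * R] (fun z : R * R => f (z.1 - z.2)%R * g z.2).
Proof.
move=> mf mg; apply: emeasurable_funM.
  exact: (measurableT_comp mf measurable_sub2).
exact: measurableT_comp.
Qed.

Lemma measurable_econv f g : measurable_fun [set: R] f ->
  measurable_fun [set: R] g -> (forall x, 0 <= f x) -> (forall x, 0 <= g x) ->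
  measurable_fun [set: R] (econv f g).
Proof.
move=> mf mg f0 g0.
apply: (measurable_fun_fubini_tonelli_F (m2 := mu)
  (fun z : R * R => f (z.1 - z.2)%R * g z.2)) => //.
  exact: measurable_conv_integrand.
by move=> z; exact: mule_ge0.
Qed.

Lemma measurable_subl f (x : R) : measurable_fun [set: R] f ->
  measurable_fun [set: R] (fun u : R => f (x - u)%R).
Proof. by move=> mf; apply: (measurableT_comp mf); exact: measurable_funB. Qed.

Lemma measurable_shift f (x : R) : measurable_fun [set: R] f ->
  measurable_fun [set: R] (fun u : R => f (u + x)%R).
Proof.
by move=> mf; apply: (measurableT_comp mf); exact: measurable_funD.
Qed.

(** Translating the inner variable by u turns the integrand of the left-hand side into f(x-w) g(w-u)
    h(u); Tonelli then exchanges u and w. *)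
Lemma econvA f g h :
  measurable_fun [set: R] f -> measurable_fun [set: R] g ->
  measurable_fun [set: R] h ->
  (forall x, 0 <= f x) -> (forall x, 0 <= g x) -> (forall x, 0 <= h x) ->
  forall x, econv (econv f g) h x = econv f (econv g h) x.
Proof.
move=> mf mg mh f0 g0 h0 x.
transitivity (\int[mu]_u \int[mu]_w (f (x - w)%R * g (w - u)%R * h u)).
  apply: eq_integral => u _; rewrite /econv.
  rewrite -(@ge0_integral_shift R (fun v => f (x - u - v)%R * g v) (- u));
    last 2 first.
  - by apply: emeasurable_funM => //; exact: measurable_subl.
  - by move=> v; exact: mule_ge0.
  rewrite -ge0_integralZr//.
  - by apply: eq_integral => w _; congr (f _ * _ * _); lra.
  - apply: emeasurable_funM; last exact: measurable_shift.
    exact: measurable_shift (measurable_subl _ mf).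
  - by move=> w _; exact: mule_ge0.
rewrite (@fubini_tonelli _ _ _ _ _ mu mu
  (fun z : R * R => f (x - z.2)%R * g (z.2 - z.1)%R * h z.1)); last 2 first.
- apply: emeasurable_funM; last exact: measurableT_comp.
  apply: emeasurable_funM; apply: measurableT_comp => //;
  exact: measurable_funB.
- by move=> z; rewrite !mule_ge0.
apply: eq_integral => w _; rewrite /econv -ge0_integralZl//.
- by apply: eq_integral => u _; rewrite /= muleA.
- by apply: emeasurable_funM => //; exact: measurable_subl.
- by move=> u _; exact: mule_ge0.
Qed.

Lemma integral_econv f g :
  measurable_fun [set: R] f -> measurable_fun [set: R] g ->
  (forall x, 0 <= f x) -> (forall x, 0 <= g x) ->
  \int[mu]_x econv f g x = (\int[mu]_x f x) * \int[mu]_x g x.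
Proof.
move=> mf mg f0 g0.
rewrite /econv (@fubini_tonelli _ _ _ _ _ mu mu
  (fun z : R * R => f (z.1 - z.2)%R * g z.2)); last 2 first.
- exact: measurable_conv_integrand.
- by move=> z; exact: mule_ge0.
rewrite -ge0_integralZl//; last exact: integral_ge0.
apply: eq_integral => u _ /=; rewrite ge0_integralZr//.
- by rewrite (@ge0_integral_shift R f (- u)).
- exact: measurable_shift.
Qed.

Lemma eq_econvr f g1 g2 x : (forall u, g1 u = g2 u) -> econv f g1 x = econv f g2 x.
Proof. by move=> e; apply: eq_integral => u _; rewrite e. Qed.

End convolution.

(** * Gamma densities *)

Section gamma_kernel.
Context {R : realType}.
Local Notation mu := (@lebesgue_measure R).

(* Kernels on the half-line are cut off by [heaviside], so that all integrals
   and convolutions run over the whole line. *)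
Definition heaviside (y : R) : R := (0 < y)%R%:R.

(** Closed counterpart of [heaviside]: since [heaviside y + heaviside0 (- y) = 1] for every y, a cut
    splits an integrand exactly, the cut point included. *)
Definition heaviside0 (y : R) : R := (0 <= y)%R%:R.

(** Spelled through exp and ln, so that joint measurability in (s, t) is immediate and exponents
    combine by [expRD]; the cutoff hides the default value of [ln]. *)
Definition pow_kernel (s t : R) : R := heaviside t * expR ((s - 1) * ln t).

Definition gamma_kernel (s t : R) : R := pow_kernel s t * expR (- t).

Local Notation hv := heaviside.
Local Notation hv0 := heaviside0.
Local Notation k := gamma_kernel.

Lemma heaviside_ge0 y : 0 <= hv y. Proof. exact: ler0n. Qed.

Lemma heaviside0_ge0 y : 0 <= hv0 y. Proof. exact: ler0n. Qed.

Lemma heaviside_pos y : 0 < y -> hv y = 1.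
Proof. by rewrite /hv => ->. Qed.

Lemma heaviside_neg y : y <= 0 -> hv y = 0.
Proof. by rewrite /hv leNgt => /negbTE ->. Qed.

Lemma heaviside_le1 y : hv y <= 1.
Proof. by rewrite /hv; case: (0 < y); rewrite ?ler01. Qed.

Lemma measurable_heaviside : measurable_fun [set: R] hv.
Proof.
rewrite (_ : hv = \1_(`]0, +oo[%classic)); first exact: measurable_indic.
by apply/funext => y; rewrite indicE mem_setE in_itv/= andbT.
Qed.

Lemma measurable_heaviside0 : measurable_fun [set: R] hv0.
Proof.
rewrite (_ : hv0 = \1_(`[0, +oo[%classic)); first exact: measurable_indic.
by apply/funext => y; rewrite indicE mem_setE in_itv/= andbT.
Qed.

Lemma pow_kernel_ge0 s t : 0 <= pow_kernel s t.
Proof. by rewrite mulr_ge0 ?heaviside_ge0 ?expR_ge0. Qed.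

Lemma gamma_kernel_ge0 s t : 0 <= k s t.
Proof. by rewrite mulr_ge0 ?pow_kernel_ge0 ?expR_ge0. Qed.

Lemma pow_kernel_gt0 s t : 0 < t -> 0 < pow_kernel s t.
Proof. by move=> t0; rewrite /pow_kernel heaviside_pos// mul1r expR_gt0. Qed.

Lemma gamma_kernel_gt0 s t : 0 < t -> 0 < k s t.
Proof. by move=> t0; rewrite mulr_gt0 ?pow_kernel_gt0 ?expR_gt0. Qed.

Lemma pow_kernel_le0 s t : t <= 0 -> pow_kernel s t = 0.
Proof. by move=> t0; rewrite /pow_kernel heaviside_neg// mul0r. Qed.

Lemma gamma_kernel_le0 s t : t <= 0 -> k s t = 0.
Proof. by move=> t0; rewrite /k pow_kernel_le0// mul0r. Qed.

Lemma pow_kernelE s t : 0 < t -> pow_kernel s t = t `^ (s - 1).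
Proof. by move=> t0; rewrite /pow_kernel heaviside_pos// mul1r /powR gt_eqF. Qed.

Lemma gamma_kernelE s t : 0 < t -> k s t = t `^ (s - 1) * expR (- t).
Proof. by move=> t0; rewrite /k pow_kernelE. Qed.

Lemma measurable_pow_kernel2 :
  measurable_fun [set: R * R] (fun z : R * R => pow_kernel z.1 z.2).
Proof.
apply: measurable_funM.
  by apply: measurableT_comp => //; exact: measurable_heaviside.
apply: measurableT_comp => //; apply: measurable_funM.
  by apply: measurable_funB.
by apply: measurableT_comp => //; exact: measurable_ln.
Qed.

Lemma measurable_gamma_kernel2 :
  measurable_fun [set: R * R] (fun z : R * R => k z.1 z.2).
Proof.
apply: measurable_funM; first exact: measurable_pow_kernel2.
by apply: measurableT_comp => //; exact: measurableT_comp.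
Qed.

Lemma measurable_pow_kernel s : measurable_fun [set: R] (pow_kernel s).
Proof.
exact: (measurableT_comp measurable_pow_kernel2 (pair1_measurable s)).
Qed.

Lemma measurable_gamma_kernel s : measurable_fun [set: R] (k s).
Proof.
exact: (measurableT_comp measurable_gamma_kernel2 (pair1_measurable s)).
Qed.

Lemma pow_kernelM s x y : 0 < x ->
  pow_kernel s (x * y) = expR ((s - 1) * ln x) * pow_kernel s y.
Proof.
move=> x0; rewrite /pow_kernel /heaviside pmulr_rgt0//.
case: (ltP 0 y) => y0; last by rewrite !mul0r mulr0.
by rewrite lnM ?posrE// !mul1r -expRD -mulrDr.
Qed.

Local Open Scope ereal_scope.

(** Extended valued, so that the relation with the Beta integral can be stated before finiteness is
    known, and then used to prove it. *)
Definition eGamma (s : R) : \bar R := \int[mu]_t (k s t)%:E.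

Definition eBeta (r s : R) : \bar R :=
  \int[mu]_v (pow_kernel r (1 - v) * pow_kernel s v)%:E.

Lemma measurable_EFin_gamma_kernel s : measurable_fun [set: R] (EFin \o k s).
Proof. by apply/measurable_EFinP; exact: measurable_gamma_kernel. Qed.

Lemma measurable_Beta_integrand r s : measurable_fun [set: R]
  (fun v : R => (pow_kernel r (1 - v) * pow_kernel s v)%:E).
Proof.
apply/measurable_EFinP; apply: measurable_funM.
  by apply: (measurableT_comp (measurable_pow_kernel r)); exact: measurable_funB.
exact: measurable_pow_kernel.
Qed.

(** The substitution u = x v pulls out x^(r+s-1) e^(-x) and leaves Euler's Beta integral, which the
    cutoffs confine to 0 < v < 1. *)
Lemma econv_gamma_kernel r s x :
  econv (EFin \o k r) (EFin \o k s) x = eBeta r s * (k (r + s) x)%:E.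
Proof.
have [x0|x0] := ltP 0%R x; last first.
  rewrite gamma_kernel_le0// mule0; apply: integral0_eq => u _ /=.
  have [u0|u0] := ltP 0%R u; last by rewrite (@gamma_kernel_le0 s)// mule0.
  by rewrite (@gamma_kernel_le0 r) ?mul0e// subr_le0 (le_trans x0)// ltW.
rewrite /econv -(@ge0_integral_dilate R _ x)//; last 2 first.
- apply: emeasurable_funM; last exact: measurable_EFin_gamma_kernel.
  exact: measurable_subl (measurable_EFin_gamma_kernel r).
- by move=> u /=; rewrite -EFinM lee_fin mulr_ge0 ?gamma_kernel_ge0.
have -> : (fun v : R => (EFin \o k r) (x - x * v)%R * (EFin \o k s) (x * v)%R) =
  (fun v => (expR ((r - 1) * ln x) * expR ((s - 1) * ln x) * expR (- x))%R%:E *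
            (pow_kernel r (1 - v) * pow_kernel s v)%R%:E).
  apply/funext => v /=; rewrite -!EFinM; congr EFin.
  rewrite /k (_ : x - x * v = x * (1 - v))%R; last by rewrite mulrBr mulr1.
  rewrite !pow_kernelM//.
  have -> : expR (- x) = (expR (- (x * (1 - v))) * expR (- (x * v)))%R.
    by rewrite -expRD; congr expR; ring.
  by ring.
rewrite ge0_integralZl_EFin ?mulr_ge0 ?expR_ge0//; last 2 first.
- by move=> v _; rewrite lee_fin mulr_ge0 ?pow_kernel_ge0.
- exact: measurable_Beta_integrand.
rewrite muleA -EFinM muleC -/(eBeta r s); congr (_ * EFin _).
rewrite /k /pow_kernel heaviside_pos// mul1r -{1}(lnK x0) !mulrA -!expRD.
by congr expR; ring.
Qed.

Lemma eGamma_ge0 s : 0 <= eGamma s.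
Proof. by apply: integral_ge0 => t _; rewrite lee_fin gamma_kernel_ge0. Qed.

Lemma eBeta_ge0 r s : 0 <= eBeta r s.
Proof.
by apply: integral_ge0 => t _; rewrite lee_fin mulr_ge0 ?pow_kernel_ge0.
Qed.

(** Total masses in [econv_gamma_kernel]: the mass of a convolution is the product of the masses. *)
Lemma eGammaM r s : eGamma r * eGamma s = eBeta r s * eGamma (r + s).
Proof.
rewrite /eGamma -integral_econv//.
- under eq_integral do rewrite econv_gamma_kernel.
  rewrite ge0_integralZl//.
  + exact: measurable_EFin_gamma_kernel.
  + by move=> x _; rewrite lee_fin gamma_kernel_ge0.
  + exact: eBeta_ge0.
- exact: measurable_EFin_gamma_kernel.
- exact: measurable_EFin_gamma_kernel.
- by move=> x; rewrite lee_fin gamma_kernel_ge0.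
- by move=> x; rewrite lee_fin gamma_kernel_ge0.
Qed.

(** A zero integral would force f to vanish off a null set, and that null set would contain the
    whole interval between p and q. *)
Lemma integral_gt0_itv (f : R -> \bar R) (p q : R) : (p < q)%R ->
  measurable_fun [set: R] f -> (forall x, 0 <= f x) ->
  (forall x, (p < x < q)%R -> 0 < f x) -> 0 < \int[mu]_x f x.
Proof.
move=> pq mf f0 fpq; rewrite lt0e integral_ge0// andbT; apply/eqP => f_eq0.
have /(ae_eq_integral_abs mu measurableT mf) : \int[mu]_x `|f x| = 0.
  by rewrite -f_eq0; apply: eq_integral => x _; rewrite gee0_abs.
move=> [A [mA A0 fA]].
have : mu `]p, q[%classic <= mu A.
  apply: le_measure; rewrite ?inE//= => x/=; rewrite in_itv/= => xpq.
  apply: fA => /= /(_ I) fx0; have := fpq _ xpq; rewrite fx0.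
  by rewrite ltxx.
by rewrite A0 lebesgue_measure_itv/= lte_fin pq -EFinB lee_fin subr_le0 leNgt pq.
Qed.

Lemma eGamma_gt0 s : 0 < eGamma s.
Proof.
apply: (@integral_gt0_itv _ 0 1) => //.
- exact: measurable_EFin_gamma_kernel.
- by move=> x; rewrite lee_fin gamma_kernel_ge0.
- by move=> x /andP[x0 _]; rewrite lte_fin gamma_kernel_gt0.
Qed.

Lemma eBeta_gt0 r s : 0 < eBeta r s.
Proof.
apply: (@integral_gt0_itv _ 0 1) => //.
- exact: measurable_Beta_integrand.
- by move=> x; rewrite lee_fin mulr_ge0 ?pow_kernel_ge0.
- move=> x /andP[x0 x1]; rewrite lte_fin mulr_gt0 ?pow_kernel_gt0//.
  by rewrite subr_gt0.
Qed.

End gamma_kernel.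

(** * Finiteness of Gamma and its size near 0 *)

Section gamma_estimates.
Context {R : realType}.
Local Notation mu := (@lebesgue_measure R).
Local Notation hv := (@heaviside R).
Local Notation hv0 := (@heaviside0 R).
Local Notation k := (@gamma_kernel R).

Lemma integral_itv_powR (s c d : R) : 0 < s -> 0 < c -> c < d ->
  (\int[mu]_(t in `[c, d]) (pow_kernel s t)%:E = ((d `^ s - c `^ s) / s)%:E)%E.
Proof.
move=> s0 c0 cd.
have pos x : x \in `[c, d] -> 0 < x.
  by rewrite in_itv/= => /andP[cx _]; exact: lt_le_trans cx.
have contP (a x : R) : 0 < x -> {for x, continuous (@powR R ^~ a)}.
  move=> x0; apply/differentiable_continuous/derivable1_diffP.
  by apply: derivable_powR; rewrite in_itv/= andbT.
transitivity (\int[mu]_(t in `[c, d]) (t `^ (s - 1))%:E)%E.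
  by apply: eq_integral => t; rewrite inE/= => /pos t0; rewrite pow_kernelE.
rewrite (@continuous_FTC2 R _ (fun t => s^-1 * t `^ s)%R c d)//.
- by rewrite -EFinB; congr EFin; rewrite -mulrBr mulrC.
- apply/continuous_within_itvP => //; split.
  + move=> x; rewrite in_itv/= => /andP[cx _]; apply: contP.
    exact: lt_trans cx.
  + by apply: cvg_at_right_filter; exact: contP.
  + by apply: cvg_at_left_filter; apply: contP; exact: lt_trans cd.
- split.
  + move=> x; rewrite in_itv/= => /andP[cx _]; apply: derivableM => //.
    by apply: derivable_powR; rewrite in_itv/= andbT (lt_trans c0).
  + apply: cvg_at_right_filter; apply: cvgM; first exact: cvg_cst.
    exact: contP.
  + apply: cvg_at_left_filter; apply: cvgM; first exact: cvg_cst.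
    by apply: contP; exact: lt_trans cd.
- move=> x; rewrite in_itv/= => /andP[cx _].
  have x0 : 0 < x by exact: lt_trans cx.
  rewrite derive1Ml; last by apply: derivable_powR; rewrite in_itv/= andbT.
  rewrite powR_derive1; last by rewrite in_itv/= andbT.
  by rewrite mulrA mulVf ?gt_eqF// mul1r.
Qed.

Lemma integral_pow_kernel (s d : R) : 0 < s -> 0 < d ->
  (\int[mu]_(t in `]0%R, d]) (pow_kernel s t)%:E = (d `^ s / s)%:E)%E.
Proof.
(* The integral is improper at 0 when s < 1, so it is exhausted from the right. The factor 1/2 makes
   [c n < d] strict already at n = 0, where [harmonic] equals 1. *)
move=> s0 d0; pose c n : R := d / 2 * harmonic n.
have c0 n : 0 < c n by rewrite mulr_gt0 ?harmonic_gt0 ?divr_gt0.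
have cd n : c n < d.
  rewrite /c/= -mulrA gtr_pMr// -invfM invf_lt1 ?mulr_gt0//.
  by rewrite -natrM ltr1n mul2n doubleS.
have cvgc : c @ \oo --> 0.
  by rewrite -(mulr0 (d / 2)); apply: cvgM; [exact: cvg_cst|exact: cvg_harmonic].
have cvgcs : (c n) `^ s @[n --> \oo] --> (0 : R).
  by have /cvg_at_rightP := powR_cvg0 s0; apply; split.
have -> : `]0, d]%classic = \bigcup_n `[c n, d]%classic.
  apply/seteqP; split => [x/=|x [n _]/=]; rewrite !in_itv/=; last first.
    by move=> /andP[cx ->]; rewrite andbT; exact: lt_le_trans cx.
  move=> /andP[x0 xd].
  have [N _ /(_ N (leqnn N)) NP] := (cvgrPdist_le _ _ ).1 cvgc x x0.
  exists N => //=; rewrite in_itv/= xd andbT.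
  by move: NP; rewrite sub0r normrN gtr0_norm.
have cvgI : (\int[mu]_(t in `[c n, d]) (pow_kernel s t)%:E @[n --> \oo] -->
    (d `^ s / s)%:E)%E.
  rewrite (_ : (fun n => _) = fun n => ((d `^ s - c n `^ s) / s)%:E); last first.
    by apply/funext => n; exact: integral_itv_powR.
  apply: cvg_EFin; first exact: nearW.
  rewrite -[X in X / s]subr0; apply: cvgM; last exact: cvg_cst.
  by apply: cvgB => //; exact: cvg_cst.
apply: (cvg_unique _ _ cvgI) => //.
apply: ge0_nondecreasing_set_cvg_integral => //.
- move=> m n mn; rewrite subsetEset => x /=; rewrite !in_itv/= => /andP[cx ->].
  rewrite andbT (le_trans _ cx)// /c ler_pM2l ?divr_gt0//.
  by rewrite lef_pV2 ?posrE ?ltr0n// ler_nat.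
- move=> n; apply: measurable_funTS; apply/measurable_EFinP.
  exact: measurable_pow_kernel.
- by move=> n x _; rewrite lee_fin pow_kernel_ge0.
Qed.

Local Open Scope ereal_scope.

Lemma eGamma1_le1 : eGamma (1 : R) <= 1.
Proof.
rewrite -(integral_exponential_pdf (ltr01 : (0 < 1 :> R)%R)).
apply: ge0_le_integral => //.
- by move=> t _; rewrite lee_fin gamma_kernel_ge0.
- exact: measurable_EFin_gamma_kernel.
- by apply/measurable_EFinP; exact: measurable_exponential_pdf.
- move=> t _; rewrite lee_fin.
  have [t0|t0] := ltP 0%R t; last first.
    by rewrite gamma_kernel_le0// exponential_pdf_ge0.
  rewrite gamma_kernelE// subrr powRr0 mul1r /exponential_pdf patchE ifT//.
    by rewrite mulN1r mul1r.
  by rewrite mem_setE in_itv/= ltW.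
Qed.

(** Split at t = 1: the integrand is at most t^(s-1) below and at most e^(-t) above, so Gamma(s) <=
    1/s + 1. This gives the upper half of the limit s Gamma(s) -> 1. *)
Lemma eGamma_le (s : R) : (0 < s <= 1)%R -> s%:E * eGamma s <= (1 + s)%:E.
Proof.
move=> /andP[s0 s1].
have mb : measurable_fun [set: R] ((EFin \o pow_kernel s) \_ `]0%R, 1%R]).
  apply/(measurable_restrictT _ _).1 => //; apply: measurable_funTS.
  by apply/measurable_EFinP; exact: measurable_pow_kernel.
have le1 : eGamma s <= (s^-1)%:E + 1.
  have -> : (s^-1)%:E = \int[mu]_t ((EFin \o pow_kernel s) \_ `]0%R, 1%R]) t.
    by rewrite -integral_mkcond integral_pow_kernel// powR1 div1r.
  apply: (@le_trans _ _ 
    (\int[mu]_t (((EFin \o pow_kernel s) \_ `]0%R, 1%R]) t + (k 1 t)%:E))).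
    apply: ge0_le_integral => //.
    - by move=> t _; rewrite lee_fin gamma_kernel_ge0.
    - exact: measurable_EFin_gamma_kernel.
    - by apply: emeasurable_funD => //; exact: measurable_EFin_gamma_kernel.
    - move=> t _; rewrite patchE mem_setE in_itv/=.
      have [t0|t0] := ltP 0%R t; last first.
        by rewrite /= !gamma_kernel_le0// adde0.
      case: (leP t 1%R) => t1 /=.
        rewrite -EFinD lee_fin -[leLHS]addr0 lerD ?gamma_kernel_ge0//.
        rewrite /k ler_piMr ?pow_kernel_ge0//.
        by rewrite -expR0 ler_expR oppr_le0 ltW.
      rewrite add0e lee_fin !gamma_kernelE//.
      by rewrite ler_pM2r ?expR_gt0// ler_powR ?lerB// ltW.
  rewrite ge0_integralD//.
  - by rewrite leeD2l// eGamma1_le1.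
  - by move=> t _; apply: erestrict_ge0 => u _; rewrite lee_fin pow_kernel_ge0.
  - by move=> t _; rewrite lee_fin gamma_kernel_ge0.
  - exact: measurable_EFin_gamma_kernel.
apply: (@le_trans _ _ (s%:E * ((s^-1)%:E + 1))); first by rewrite lee_pmul2l.
by rewrite -EFinD -EFinM lee_fin mulrDr mulfV ?gt_eqF// mulr1.
Qed.

(** By [eGammaM], Gamma(r/2)^2 = B(r/2, r/2) Gamma(r) with a positive Beta factor, so an infinite
    Gamma(r) would make Gamma(r/2) infinite. Halving thus carries finiteness from r <= n+1 to r <=
    n+2, starting from [eGamma_le] on r <= 1. *)
Lemma eGamma_lty (s : R) : (0 < s)%R -> eGamma s < +oo.
Proof.
have sq (z : \bar R) : 0 <= z -> z < +oo -> z * z < +oo.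
  by case: z => // z _ _; rewrite -EFinM ltry.
have small (r : R) : (0 < r <= 1)%R -> eGamma r < +oo.
  move=> /[dup] /andP[r0 _] /eGamma_le; case: (eGamma r) => [x|//|//].
    by rewrite ltry.
  by rewrite gt0_muley ?lte_fin// leye_eq.
have step n : forall r : R, (0 < r <= n.+1%:R)%R -> eGamma r < +oo.
  elim: n => [|n IH] r; first exact: small.
  move=> /andP[r0 rn].
  have r2 : (0 < r / 2 <= n.+1%:R)%R.
    rewrite divr_gt0//= ler_pdivrMr// (le_trans rn)// -natrM ler_nat.
    by rewrite muln2 -addnn addSn ltnS leq_addl.
  have := eGammaM (r / 2) (r / 2).
  rewrite -splitr => e; rewrite ltNge leye_eq; apply/negP => /eqP rE.
  have : eGamma (r / 2) * eGamma (r / 2) < +oo.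
    exact: sq (eGamma_ge0 _) (IH _ r2).
  by rewrite e rE gt0_muley ?eBeta_gt0.
move=> s0; apply: (step (Num.truncn s)).
by rewrite s0 ltW// truncnS_gt.
Qed.

End gamma_estimates.

(** * Linearity, monotonicity and Tonelli for convolutions *)

Section econv_linear.
Context {R : realType}.
Local Notation mu := (@lebesgue_measure R).
Local Open Scope ereal_scope.
Implicit Types f g : R -> \bar R.

Lemma econvDl f1 f2 g x :
  measurable_fun [set: R] f1 -> measurable_fun [set: R] f2 ->
  measurable_fun [set: R] g ->
  (forall x, 0 <= f1 x) -> (forall x, 0 <= f2 x) -> (forall x, 0 <= g x) ->
  econv (fun y => f1 y + f2 y) g x = econv f1 g x + econv f2 g x.
Proof.
move=> mf1 mf2 mg f10 f20 g0; rewrite /econv -ge0_integralD//.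
- by apply: eq_integral => u _; rewrite ge0_muleDl.
- by move=> u _; exact: mule_ge0.
- by apply: emeasurable_funM => //; exact: measurable_subl.
- by move=> u _; exact: mule_ge0.
- by apply: emeasurable_funM => //; exact: measurable_subl.
Qed.

Lemma econvZl (c : \bar R) f g x :
  measurable_fun [set: R] f -> measurable_fun [set: R] g ->
  0 <= c -> (forall x, 0 <= f x) -> (forall x, 0 <= g x) ->
  econv (fun y => c * f y) g x = c * econv f g x.
Proof.
move=> mf mg c0 f0 g0; rewrite /econv -ge0_integralZl//.
- by apply: eq_integral => u _; rewrite muleA.
- by apply: emeasurable_funM => //; exact: measurable_subl.
- by move=> u _; exact: mule_ge0.
Qed.

Lemma econvZr (c : \bar R) f g x :
  measurable_fun [set: R] f -> measurable_fun [set: R] g ->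
  0 <= c -> (forall x, 0 <= f x) -> (forall x, 0 <= g x) ->
  econv f (fun y => c * g y) x = c * econv f g x.
Proof.
move=> mf mg c0 f0 g0; rewrite /econv -ge0_integralZl//.
- by apply: eq_integral => u _; rewrite muleCA.
- by apply: emeasurable_funM => //; exact: measurable_subl.
- by move=> u _; exact: mule_ge0.
Qed.

Lemma le_econv f1 f2 g x :
  measurable_fun [set: R] f1 -> measurable_fun [set: R] f2 ->
  measurable_fun [set: R] g ->
  (forall x, 0 <= f1 x) -> (forall x, 0 <= g x) ->
  (forall u, 0 < g u -> f1 (x - u)%R <= f2 (x - u)%R) ->
  econv f1 g x <= econv f2 g x.
Proof.
move=> mf1 mf2 mg f10 g0 f12; apply: ge0_le_integral => //.
- by move=> u _; exact: mule_ge0.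
- by apply: emeasurable_funM => //; exact: measurable_subl.
- by apply: emeasurable_funM => //; exact: measurable_subl.
- move=> u _; have := g0 u; rewrite le_eqVlt => /predU1P[<-|gu].
    by rewrite !mule0.
  by apply: lee_pmul => //; exact: f12.
Qed.

Lemma econv_integralr f (g : R -> R -> \bar R) x :
  measurable_fun [set: R] f -> (forall x, 0 <= f x) ->
  measurable_fun [set: R * R] (fun z : R * R => g z.1 z.2) ->
  (forall s u, 0 <= g s u) ->
  econv f (fun u => \int[mu]_s g s u) x = \int[mu]_s econv f (g s) x.
Proof.
move=> mf f0 mg g0; rewrite /econv.
rewrite [RHS](@fubini_tonelli _ _ _ _ _ mu mu
  (fun z : R * R => f (x - z.2)%R * g z.1 z.2)); last 2 first.
- apply: emeasurable_funM => //.
  exact: (measurableT_comp (measurable_subl x mf)).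
- by move=> z; exact: mule_ge0.
apply: eq_integral => u _; rewrite /= ge0_integralZl//.
exact: measurable_fun_pair1 mg.
Qed.

End econv_linear.

(** * Normalised Gamma densities and the additive telescoping identity *)

Section gamma_density.
Context {R : realType}.
Local Notation mu := (@lebesgue_measure R).
Local Notation hv := (@heaviside R).
Local Notation hv0 := (@heaviside0 R).
Local Notation k := (@gamma_kernel R).

Lemma GammaE (s : R) : Gamma s = fine (eGamma s).
Proof.
rewrite /Gamma /Rintegral integral_mkcond; congr fine.
apply: eq_integral => t _; rewrite patchE mem_setE in_itv/= andbT.
by case: ltP => t0 /=; [rewrite gamma_kernelE|rewrite gamma_kernel_le0].
Qed.

Lemma EFin_Gamma (s : R) : 0 < s -> (Gamma s)%:E = eGamma s.
Proof.
by move=> s0; rewrite GammaE fineK// ge0_fin_numE ?eGamma_ge0// eGamma_lty.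
Qed.

Lemma Gamma_gt0 (s : R) : 0 < s -> 0 < Gamma s.
Proof. by move=> s0; rewrite -lte_fin EFin_Gamma// eGamma_gt0. Qed.

Lemma Gamma_ge0 (s : R) : 0 <= Gamma s.
Proof. by rewrite GammaE fine_ge0// eGamma_ge0. Qed.

Lemma measurable_Gamma : measurable_fun [set: R] (@Gamma R).
Proof.
rewrite (_ : @Gamma R = fine \o eGamma); last by apply/funext => s; exact: GammaE.
apply: measurableT_comp => //.
apply: (measurable_fun_fubini_tonelli_F (m2 := mu)
  (fun z : R * R => (k z.1 z.2)%:E)).
  by apply/measurable_EFinP; exact: measurable_gamma_kernel2.
by move=> z; rewrite lee_fin gamma_kernel_ge0.
Qed.

(** The density g_s of the overview, also cut off in its parameter, so that integrals over s run
    over the whole line. *)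
Definition gamma_density (s t : R) : R := hv s * (k s t / Gamma s).
Local Notation p := gamma_density.

Lemma gamma_density_ge0 s t : 0 <= p s t.
Proof.
by rewrite mulr_ge0 ?heaviside_ge0// divr_ge0 ?Gamma_ge0// gamma_kernel_ge0.
Qed.

Lemma gamma_density_nparam s t : s <= 0 -> p s t = 0.
Proof. by move=> s0; rewrite /p heaviside_neg// mul0r. Qed.

Lemma gamma_density_le0 s t : t <= 0 -> p s t = 0.
Proof. by move=> t0; rewrite /p gamma_kernel_le0// mul0r mulr0. Qed.

Lemma gamma_density_gt0_arg s t : 0 < p s t -> 0 < t.
Proof.
move=> p0; rewrite ltNge; apply: contraTN p0 => t0.
by rewrite gamma_density_le0// ltxx.
Qed.

Lemma measurable_gamma_density2 :
  measurable_fun [set: R * R] (fun z : R * R => p z.1 z.2).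
Proof.
(* Division by Gamma becomes multiplication by exp(- ln Gamma), visibly measurable. This is
   legitimate where Gamma is positive, that is for s > 0; elsewhere the cutoff annihilates both
   sides. *)
rewrite (_ : (fun z => _) =
    fun z => hv z.1 * (k z.1 z.2 * expR (- ln (Gamma z.1)))); last first.
  apply/funext => -[s t]; rewrite /p /=; have [s0|s0] := ltP 0 s; last first.
    by rewrite heaviside_neg// !mul0r.
  by rewrite -lnV ?lnK ?posrE ?invr_gt0 ?Gamma_gt0.
apply: measurable_funM.
  by apply: measurableT_comp => //; exact: measurable_heaviside.
apply: measurable_funM; first exact: measurable_gamma_kernel2.
apply: measurableT_comp => //; apply: measurable_funN.
apply: (measurableT_comp (@measurable_ln R)).
by apply: (measurableT_comp measurable_Gamma).
Qed.

Lemma measurable_gamma_density s : measurable_fun [set: R] (EFin \o p s).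
Proof.
apply/measurable_EFinP.
exact: measurableT_comp measurable_gamma_density2 (pair1_measurable s).
Qed.

Local Open Scope ereal_scope.

Lemma EFin_gamma_density_ge0 s t : 0 <= (EFin \o p s) t.
Proof. by rewrite lee_fin gamma_density_ge0. Qed.

(** The semigroup law, with the Beta factor eliminated by [eGammaM]. The left factor stays
    unnormalised because the tail [upper_gamma r] is built from [k r]. *)
Lemma econv_kernel_density r s x : (0 < r)%R -> (0 < s)%R ->
  econv (EFin \o k r) (EFin \o p s) x = eGamma r * (p (r + s) x)%:E.
Proof.
move=> r0 s0; have rs0 : (0 < r + s)%R by exact: addr_gt0.
have -> : (EFin \o p s) = (fun u => ((Gamma s)^-1)%:E * (EFin \o k s) u).
  by apply/funext => u; rewrite /= -EFinM /p heaviside_pos// mul1r mulrC.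
have mk := @measurable_EFin_gamma_kernel R.
have k0 q t : 0 <= (EFin \o k q) t by rewrite lee_fin gamma_kernel_ge0.
rewrite econvZr ?lee_fin ?invr_ge0 ?Gamma_ge0//.
rewrite econv_gamma_kernel.
have := eGammaM r s; rewrite -!EFin_Gamma//.
have : eBeta r s \is a fin_num.
  rewrite ge0_fin_numE ?eBeta_ge0// ltNge leye_eq; apply/negP => /eqP B.
  have := eGammaM r s; rewrite B -!EFin_Gamma//.
  by rewrite gt0_mulye// lte_fin Gamma_gt0.
have := Gamma_gt0 s0; have := Gamma_gt0 rs0; rewrite /p heaviside_pos// mul1r.
move: (Gamma r) (Gamma s) (Gamma _) (k _ x) => gr gs grs kx grs0 gs0.
case: (eBeta r s) => // B _; rewrite -!EFinM => -[] e; congr EFin.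
apply: (mulIf (lt0r_neq0 gs0)); apply: (mulIf (lt0r_neq0 grs0)).
transitivity (B * grs * kx)%R; first by field; exact: lt0r_neq0.
by rewrite -e; field; exact: lt0r_neq0.
Qed.

(** The upper incomplete Gamma function U_r, cut off to y > 0. At r = 0 it is E_1, see
    [causal_expint1]. *)
Definition upper_gamma (r y : R) : \bar R :=
  \int[mu]_t (hv y * hv0 (t - y) * k r t)%:E.

Lemma measurable_upper_integrand r : measurable_fun [set: R * R]
  (fun z : R * R => (hv z.1 * hv0 (z.2 - z.1) * k r z.2)%:E).
Proof.
apply/measurable_EFinP; apply: measurable_funM.
  apply: measurable_funM.
    by apply: measurableT_comp => //; exact: measurable_heaviside.
  apply: (measurableT_comp measurable_heaviside0).
  exact: measurable_funB.
by apply: measurableT_comp => //; exact: measurable_gamma_kernel.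
Qed.

Lemma upper_integrand_ge0 r y t : 0 <= (hv y * hv0 (t - y) * k r t)%:E.
Proof.
by rewrite lee_fin !mulr_ge0 ?heaviside_ge0 ?heaviside0_ge0 ?gamma_kernel_ge0.
Qed.

Lemma upper_gamma_ge0 r y : 0 <= upper_gamma r y.
Proof. by apply: integral_ge0 => t _; exact: upper_integrand_ge0. Qed.

Lemma measurable_upper_gamma r : measurable_fun [set: R] (upper_gamma r).
Proof.
apply: (measurable_fun_fubini_tonelli_F (m2 := mu)
  (fun z : R * R => (hv z.1 * hv0 (z.2 - z.1) * k r z.2)%:E)).
  exact: measurable_upper_integrand.
by move=> z; exact: upper_integrand_ge0.
Qed.

Lemma upper_gamma_le0 r y : (y <= 0)%R -> upper_gamma r y = 0.
Proof.
by move=> y0; apply: integral0_eq => t _; rewrite heaviside_neg// !mul0r.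
Qed.

Lemma measurable_EFin_heaviside : measurable_fun [set: R] (EFin \o hv).
Proof. by apply/measurable_EFinP; exact: measurable_heaviside. Qed.

Lemma EFin_heaviside_ge0 y : 0 <= (EFin \o hv) y.
Proof. by rewrite lee_fin heaviside_ge0. Qed.

(** For y > 0, the tail beyond y and the mass below y add up to Gamma(r). Stated as a sum, it avoids
    subtraction of possibly infinite values. *)
Lemma upper_gammaD r y :
  upper_gamma r y + econv (EFin \o hv) (EFin \o k r) y = eGamma r * (hv y)%:E.
Proof.
have k0 t : 0 <= (EFin \o k r) t by rewrite lee_fin gamma_kernel_ge0.
have mk := measurable_EFin_gamma_kernel r.
rewrite /upper_gamma /econv -ge0_integralD//; last 4 first.
- by move=> t _; exact: upper_integrand_ge0.
- exact: measurable_fun_pair2 (measurable_upper_integrand r).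
- by move=> t _; rewrite mule_ge0 ?EFin_heaviside_ge0.
- apply: emeasurable_funM => //; exact: measurable_subl measurable_EFin_heaviside.
have [y0|y0] := ltP 0%R y; last first.
  rewrite heaviside_neg// mule0; apply: integral0_eq => t _.
  rewrite !mul0r add0e /=; have [t0|t0] := ltP 0%R t.
    by rewrite (@heaviside_neg _ (y - t)%R) ?mul0e// subr_le0 (le_trans y0)// ltW.
  by rewrite gamma_kernel_le0// mule0.
rewrite heaviside_pos// mule1; apply: eq_integral => t _ /=.
rewrite -EFinM -EFinD mul1r -mulrDl /hv0 /hv subr_ge0 subr_gt0 leNgt.
by case: (t < y)%R => /=; rewrite ?add0r ?addr0 mul1r.
Qed.

(** It is used with x fixed, as a function of the parameter s: this is the family that
    telescopes. *)
Definition gamma_cdf (s x : R) : \bar R := econv (EFin \o hv) (EFin \o p s) x.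

Lemma gamma_cdf_ge0 s x : 0 <= gamma_cdf s x.
Proof.
apply: econv_ge0; [exact: EFin_heaviside_ge0|exact: EFin_gamma_density_ge0].
Qed.

Lemma gamma_cdf_nparam s x : (s <= 0)%R -> gamma_cdf s x = 0.
Proof.
by move=> s0; apply: integral0_eq => u _ /=; rewrite gamma_density_nparam// mule0.
Qed.

Lemma gamma_cdf_le1 s x : gamma_cdf s x <= 1.
Proof.
have [s0|s0] := ltP 0%R s; last by rewrite gamma_cdf_nparam.
have -> : 1 = \int[mu]_u (p s u)%:E.
  rewrite (_ : (fun u => _) = (fun u => ((Gamma s)^-1)%:E * (k s u)%:E)); last first.
    by apply/funext => u; rewrite -EFinM /p heaviside_pos// mul1r mulrC.
  rewrite ge0_integralZl//.
  - rewrite -[X in _ * X]/(eGamma s) -EFin_Gamma// -EFinM mulVf//.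
    by rewrite gt_eqF// Gamma_gt0.
  - exact: measurable_EFin_gamma_kernel.
  - by move=> u _; rewrite lee_fin gamma_kernel_ge0.
  - by rewrite lee_fin invr_ge0 Gamma_ge0.
apply: ge0_le_integral => //.
- by move=> u _; rewrite mule_ge0 ?EFin_heaviside_ge0 ?EFin_gamma_density_ge0.
- apply: emeasurable_funM; last exact: measurable_gamma_density.
  exact: measurable_subl measurable_EFin_heaviside.
- exact: measurable_gamma_density.
- move=> u _ /=; rewrite -EFinM lee_fin ler_piMl ?gamma_density_ge0//.
  exact: heaviside_le1.
Qed.

Lemma measurable_gamma_cdf x : measurable_fun [set: R] (gamma_cdf ^~ x).
Proof.
apply: (measurable_fun_fubini_tonelli_F (m2 := mu)
  (fun z : R * R => (hv (x - z.2))%:E * (p z.1 z.2)%:E)).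
  apply: emeasurable_funM.
    exact: (measurableT_comp (measurable_subl x measurable_EFin_heaviside)).
  by apply/measurable_EFinP; exact: measurable_gamma_density2.
by move=> z; rewrite mule_ge0 ?EFin_heaviside_ge0 ?EFin_gamma_density_ge0.
Qed.

(** Convolve [upper_gammaD] with the density of parameter s and apply the semigroup law. The factor
    [hv s] extends the identity to s <= 0, where [gamma_cdf (s + r) x] itself need not vanish. *)
Lemma econv_upper_gamma_density r s x : (0 < r)%R ->
  econv (upper_gamma r) (EFin \o p s) x +
    eGamma r * ((hv s)%:E * gamma_cdf (s + r) x) = eGamma r * gamma_cdf s x.
Proof.
move=> r0; have [s0|s0] := ltP 0%R s; last first.
  rewrite heaviside_neg// mul0e mule0 adde0 gamma_cdf_nparam// mule0.
  by apply: integral0_eq => u _ /=; rewrite gamma_density_nparam// mule0.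
rewrite heaviside_pos// mul1e.
have mh := measurable_EFin_heaviside; have mk := measurable_EFin_gamma_kernel r.
have mp := measurable_gamma_density s.
have h0 := EFin_heaviside_ge0; have p0 := EFin_gamma_density_ge0 s.
have k0 t : 0 <= (EFin \o k r) t by rewrite lee_fin gamma_kernel_ge0.
have mkh := measurable_econv mh mk h0 k0.
have kh0 y := econv_ge0 y h0 k0.
have hkp : econv (econv (EFin \o hv) (EFin \o k r)) (EFin \o p s) x =
    eGamma r * gamma_cdf (s + r) x.
  rewrite (econvA mh mk mp h0 k0 p0) (addrC s).
  rewrite (eq_econvr _ _ (fun u => econv_kernel_density u r0 s0)).
  exact: (@econvZr R (eGamma r) _ _ x mh (measurable_gamma_density (r + s))
    (eGamma_ge0 r) h0 (EFin_gamma_density_ge0 (r + s))).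
transitivity (econv (fun y => upper_gamma r y +
    econv (EFin \o hv) (EFin \o k r) y) (EFin \o p s) x).
  rewrite (@econvDl R _ _ _ x (measurable_upper_gamma r) mkh mp
    (upper_gamma_ge0 r) kh0 p0).
  exact: (congr1 (adde _) (esym hkp)).
rewrite (funext (upper_gammaD r)).
exact: (@econvZl R (eGamma r) _ _ x mh mp (eGamma_ge0 r) h0 p0).
Qed.

End gamma_density.

(** * Sonine's identity *)

Section telescoping.
Context {R : realType}.
Local Notation mu := (@lebesgue_measure R).
Local Notation hv := (@heaviside R).
Local Notation hv0 := (@heaviside0 R).
Local Open Scope ereal_scope.
Variable G : R -> \bar R.
Hypotheses (mG : measurable_fun [set: R] G) (G0 : forall s, 0 <= G s).
Hypotheses (G1 : forall s, G s <= 1) (Gneg : forall s, (s <= 0)%R -> G s = 0).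

Let below (r s : R) : \bar R := (hv0 (r - s))%:E.
Let above (r s : R) : \bar R := (hv (s - r))%:E.

Let mbelow r : measurable_fun [set: R] (below r).
Proof.
have mh : measurable_fun [set: R] (EFin \o hv0).
  by apply/measurable_EFinP; exact: measurable_heaviside0.
exact: measurable_subl mh.
Qed.

Let mabove r : measurable_fun [set: R] (above r).
Proof. exact: measurable_shift (@measurable_EFin_heaviside R). Qed.

Let below_ge0 r s : 0 <= below r s.
Proof. by rewrite lee_fin heaviside0_ge0. Qed.

Let above_ge0 r s : 0 <= above r s.
Proof. by rewrite lee_fin heaviside_ge0. Qed.

Let mbelowG r : measurable_fun [set: R] (fun s => below r s * G s).
Proof. exact: emeasurable_funM. Qed.

Let maboveG r : measurable_fun [set: R] (fun s => above r s * G s).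
Proof. exact: emeasurable_funM. Qed.

Let belowG_ge0 r s : 0 <= below r s * G s. Proof. exact: mule_ge0. Qed.

Let aboveG_ge0 r s : 0 <= above r s * G s. Proof. exact: mule_ge0. Qed.

Lemma integral_below_le (r : R) : (0 <= r)%R ->
  \int[mu]_s ((hv0 (r - s))%:E * G s) <= r%:E.
Proof.
move=> r0; have -> : r%:E = \int[mu]_s (\1_(`]0%R, r]%classic) s)%:E.
  rewrite integral_indic// setIT/= lebesgue_measure_itv/= lte_fin.
  by case: ltP => r0'; rewrite ?sube0//; congr EFin; apply: le_anti; rewrite r0 r0'.
apply: ge0_le_integral => //.
- by move=> s _; exact: belowG_ge0.
- exact: mbelowG.
- by apply/measurable_EFinP; exact: measurable_indic.
- move=> s _; rewrite indicE mem_setE in_itv/= /hv0 subr_ge0.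
  have [s0|s0] := ltP 0%R s; last by rewrite Gneg// mule0.
  by case: (s <= r)%R => /=; rewrite ?mul1e ?mul0e.
Qed.

Lemma integral_below_above (r : R) : \int[mu]_s G s =
  \int[mu]_s ((hv0 (r - s))%:E * G s) + \int[mu]_s ((hv (s - r))%:E * G s).
Proof.
rewrite -ge0_integralD//; last 4 first.
- by move=> s _; exact: belowG_ge0.
- exact: mbelowG.
- by move=> s _; exact: aboveG_ge0.
- exact: maboveG.
apply: eq_integral => s _; rewrite /hv0 /hv subr_ge0 subr_gt0 leNgt.
by case: (r < s)%R; rewrite mul1e mul0e ?adde0 ?add0e.
Qed.

Lemma integral_shift_above (r : R) : (0 <= r)%R ->
  \int[mu]_s ((hv s)%:E * G (s + r)%R) = \int[mu]_s ((hv (s - r))%:E * G s).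
Proof.
move=> r0; rewrite -[RHS](@ge0_integral_shift _ _ r (maboveG r) (aboveG_ge0 r)).
by apply: eq_integral => s _; rewrite /above addrK.
Qed.

Variables (r gam : R) (F : R -> \bar R).
Hypotheses (r0 : (0 < r)%R) (gam0 : (0 < gam)%R).
Hypotheses (mF : measurable_fun [set: R] F) (F0 : forall s, 0 <= F s).
Hypothesis FG : forall s,
  F s + gam%:E * ((hv s)%:E * G (s + r)%R) = gam%:E * G s.

Let mhG : measurable_fun [set: R] (fun s => (hv s)%:E * G (s + r)%R).
Proof.
apply: emeasurable_funM; first exact: measurable_EFin_heaviside.
exact: measurable_shift.
Qed.

Let hG_ge0 s : 0 <= (hv s)%:E * G (s + r)%R.
Proof. by rewrite mule_ge0 ?lee_fin ?heaviside_ge0. Qed.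

(** Integrate [FG] over s and shift by r: the second term becomes the part of the integral of G
    beyond r. That part is finite, so it cancels and leaves the integral up to r. *)
Lemma integral_telescope : \int[mu]_s G s < +oo ->
  \int[mu]_s F s = gam%:E * \int[mu]_s ((hv0 (r - s))%:E * G s).
Proof.
move=> Gfin.
have : \int[mu]_s F s + gam%:E * \int[mu]_s ((hv s)%:E * G (s + r)%R) =
    gam%:E * \int[mu]_s G s.
  rewrite -!ge0_integralZl ?lee_fin ?(ltW gam0)//.
  rewrite -ge0_integralD//.
  - by apply: eq_integral => s _; exact: FG.
  - by move=> s _; rewrite mule_ge0// lee_fin ltW.
  - exact: measurable_funeM.
have A0 : 0 <= \int[mu]_s ((hv0 (r - s))%:E * G s).
  by apply: integral_ge0 => s _; exact: belowG_ge0.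
have K0 : 0 <= \int[mu]_s ((hv (s - r))%:E * G s).
  by apply: integral_ge0 => s _; exact: aboveG_ge0.
rewrite integral_shift_above ?ltW// (integral_below_above r) (ge0_muleDr _ A0 K0).
set K := \int[mu]_s ((hv (s - r))%:E * _).
have Kfin : gam%:E * K \is a fin_num.
  rewrite fin_numM// ge0_fin_numE//.
  by apply: le_lt_trans Gfin; rewrite (integral_below_above r) leeDr.
by move=> e; rewrite -[LHS](addeK _ Kfin) e addeK.
Qed.

(* Truncating the telescoped identity at T keeps everything finite; the bound
   does not depend on T. *)
Lemma integral_renewal (c : R) : (0 < c)%R -> (forall s, c%:E * G s <= F s) ->
  \int[mu]_s G s < +oo.
Proof.
move=> c0 cGF.
have trunc (T : R) : (0 <= T)%R ->
    \int[mu]_s (below T s * G s) <= (c^-1)%:E * (gam * r)%:E.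
  move=> T0; rewrite lee_pdivlMl//.
  (* I integrates G over s <= T, K over r < s <= T. The proof combines c I + gam K <= gam I, from
     [FG] and the lower bound on F, with I <= r + K, from G <= 1. Since K is at most T, it cancels
     and c I <= gam r remains. *)
  set I := \int[mu]_s _.
  set K := \int[mu]_s (below T s * (above r s * G s)).
  have mK : measurable_fun [set: R] (fun s => below T s * (above r s * G s)).
    exact: emeasurable_funM.
  have K0 s : 0 <= below T s * (above r s * G s) by exact: mule_ge0.
  have mbG := mbelowG T; have bG0 := belowG_ge0 T.
  have IK0 : 0 <= K by apply: integral_ge0 => s _; exact: K0.
  have Kfin : gam%:E * K \is a fin_num.
    rewrite fin_numM// ge0_fin_numE//.
    apply: le_lt_trans (ltry T); apply: le_trans (integral_below_le T0).
    apply: (ge0_le_integral mu measurableT (fun s _ => K0 s) mK (mbelowG T)).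
    move=> s _; apply: lee_pmul => //.
    by rewrite gee_pMl ?lee_fin ?heaviside_le1// ge0_fin_numE//
      (le_lt_trans (G1 s))// ltry.
  have IK : I <= r%:E + K.
    apply: (@le_trans _ _ (\int[mu]_s (below r s * G s) + K)); last first.
      by rewrite leeD2r// integral_below_le// ltW.
    rewrite -(ge0_integralD mu measurableT (fun s _ => belowG_ge0 r s)
      (mbelowG r) (fun s _ => K0 s) mK).
    apply: (ge0_le_integral mu measurableT (fun s _ => belowG_ge0 T s)
      (mbelowG T) (emeasurable_funD (mbelowG r) mK)).
    move=> s _; rewrite /below /above /hv0 /hv !subr_ge0 subr_gt0 (leNgt s r).
      by case: (s <= T)%R; case: (r < s)%R => /=;
      rewrite ?mul1e ?mul0e ?mule0 ?add0e ?adde0.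
  have cIK : c%:E * I + gam%:E * K <= gam%:E * I.
    have mbF : measurable_fun [set: R] (fun s => below T s * F s).
      exact: emeasurable_funM.
    have mbhG : measurable_fun [set: R]
        (fun s => below T s * ((hv s)%:E * G (s + r)%R)).
      exact: emeasurable_funM.
    have bF0 s : 0 <= below T s * F s by exact: mule_ge0.
    have bhG0 s : 0 <= below T s * ((hv s)%:E * G (s + r)%R) by exact: mule_ge0.
    have -> : gam%:E * I = \int[mu]_s (below T s * F s) +
        gam%:E * \int[mu]_s (below T s * ((hv s)%:E * G (s + r)%R)).
      rewrite /I -!ge0_integralZl ?lee_fin ?(ltW gam0)//.
      rewrite -ge0_integralD//.
      - apply: eq_integral => s _.
        have ghG0 : 0 <= gam%:E * ((hv s)%:E * G (s + r)%R).
          by rewrite mule_ge0// lee_fin ltW.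
        rewrite muleCA -FG (ge0_muleDr _ (F0 s) ghG0).
        by congr (_ + _); rewrite muleCA.
      - by move=> s _; rewrite mule_ge0// lee_fin ltW.
      - exact: measurable_funeM.
    apply: leeD.
      rewrite -ge0_integralZl ?lee_fin ?(ltW c0)//; apply: ge0_le_integral => //.
      - by move=> s _; rewrite mule_ge0// lee_fin ltW.
      - exact: measurable_funeM.
      - by move=> s _; rewrite muleCA lee_wpmul2l.
    rewrite lee_wpmul2l ?lee_fin ?(ltW gam0)//.
    (* The shifted integrand, supported on r < s <= T + r; this range contains that of K. *)
    pose q s := below T (s - r)%R * (above r s * G s).
    have mq : measurable_fun [set: R] q.
      by apply: emeasurable_funM => //; exact: measurable_shift (mbelow T).
    have q0 s : 0 <= q s by exact: mule_ge0.
    have -> : \int[mu]_s (below T s * ((hv s)%:E * G (s + r)%R)) = \int[mu]_s q s.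
      rewrite -(@ge0_integral_shift _ q r mq q0).
      by apply: eq_integral => s _; rewrite /q /above addrK.
    apply: ge0_le_integral => // s _; rewrite lee_wpmul2r//.
    rewrite /below lee_fin /hv0 !subr_ge0 lerBlDr.
    by case: (leP s T) => sT //=; rewrite (le_trans sT)// lerDl ltW.
  rewrite -(@leeD2rE _ (gam%:E * K))//; apply: (le_trans cIK).
  have r0E : 0 <= r%:E by rewrite lee_fin ltW.
  rewrite EFinM -(ge0_muleDr gam%:E r0E IK0).
  by rewrite lee_pmul2l// lte_fin.
have bound : \int[mu]_s G s <= (c^-1)%:E * (gam * r)%:E; last first.
  by apply: (le_lt_trans bound); rewrite -EFinM ltry.
pose D n : set R := `]-oo, n%:R]%classic.
have -> : \int[mu]_s G s = \int[mu]_(s in \bigcup_n D n) G s.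
  congr (integral mu _ _); apply/seteqP; split => // s _.
  by exists (Num.truncn s).+1 => //; rewrite /D/= in_itv/= ltW// truncnS_gt.
have cvgD : \int[mu]_(s in D n) G s @[n --> \oo] -->
    \int[mu]_(s in \bigcup_n D n) G s.
  apply: ge0_nondecreasing_set_cvg_integral => //.
  - move=> m n mn; rewrite subsetEset => s; rewrite /D/= !in_itv/= => /le_trans.
    by apply; rewrite ler_nat.
  - by move=> n; exact: measurable_itv.
  - by move=> n; exact: measurable_funTS.
apply: (cvge_le _ cvgD); apply: nearW => n.
rewrite integral_mkcond; apply: le_trans (trunc n%:R (ler0n _ _)).
apply: ge0_le_integral => //.
- by move=> s _; exact: erestrict_ge0.
- apply/(measurable_restrictT _ _).1; first exact: measurable_itv.
  exact: measurable_funTS.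
- exact: mbelowG.
- move=> s _; rewrite patchE mem_setE in_itv/= /below /hv0 subr_ge0.
  by case: (s <= n%:R)%R; rewrite ?mul1e ?mul0e.
Qed.

End telescoping.

(** * The Sonine kernel as a superposition of Gamma densities *)

Section sonine.
Context {R : realType}.
Local Notation mu := (@lebesgue_measure R).
Local Notation hv := (@heaviside R).
Local Notation hv0 := (@heaviside0 R).
Local Notation k := (@gamma_kernel R).
Local Notation p := (@gamma_density R).

Lemma heaviside0_le1 y : hv0 y <= 1.
Proof. by rewrite /hv0; case: (0 <= y); rewrite ?ler01. Qed.

(** Convexity of exp between 0 and l: the tangent at r l, evaluated at 0 and at l, is averaged with
    weights 1 - r and r. With l = ln t this reads t^r <= 1 + r t. *)
Lemma expR_chord (r l : R) : 0 <= r <= 1 -> expR (r * l) <= 1 + r * expR l.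
Proof.
move=> /andP[r0 r1].
have tangent z : expR (r * l) * (1 + (z - r * l)) <= expR z.
  rewrite -[X in _ <= expR X](subrK (r * l)) expRD mulrC ler_pM2r ?expR_gt0//.
  exact: expR_ge1Dx.
have := tangent l; have := tangent 0; rewrite expR0 sub0r => t0 tl.
have h0 := ler_wpM2l (_ : 0 <= 1 - r) t0.
have h1 := ler_wpM2l r0 tl.
have : (1 - r) * (expR (r * l) * (1 - r * l)) +
   r * (expR (r * l) * (1 + (l - r * l))) = expR (r * l) by ring.
have := h0 (ltac:(by rewrite subr_ge0)).
move: h1; set X := expR _; set Y := expR _; set Z := _ * (1 + _).
by set W := _ * _; lra.
Qed.

(** Every passage to the limit below takes this form, the error being a multiple of the small
    parameter. If a > 0, the value r = min(d, a/(2K)) gives r K <= a/2 < a. *)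
Lemma small_multiple_le0 (a d K : R) : 0 < d ->
  (forall r, 0 < r <= d -> a <= r * K) -> a <= 0.
Proof.
move=> d0 aK; rewrite leNgt; apply/negP => a0.
have K0 : 0 < K.
  have := aK d; rewrite d0 lexx => /(_ isT) /(lt_le_trans a0).
  by rewrite pmulr_rgt0.
have := aK (Num.min d (a / (2 * K))).
rewrite ge_min lexx lt_min d0/= !divr_gt0 ?mulr_gt0// => /(_ isT).
apply/negP; rewrite -ltNge.
apply: (@le_lt_trans _ _ (a / (2 * K) * K)).
  by rewrite ler_pM2r// ge_min lexx orbT.
have -> : a / (2 * K) * K = a / 2 by field; rewrite gt_eqF.
by rewrite gtr_pMr// invf_lt1// ltr1n.
Qed.

Local Open Scope ereal_scope.

(** Kept extended valued so that Tonelli applies as it stands; [causal_sonine] returns to the real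
    kernel. *)
Definition esonine (u : R) : \bar R := \int[mu]_s (p s u)%:E.

Lemma esonine_ge0 u : 0 <= esonine u.
Proof. by apply: integral_ge0 => s _; rewrite lee_fin gamma_density_ge0. Qed.

Lemma esonine_le0 u : (u <= 0)%R -> esonine u = 0.
Proof.
by move=> u0; apply: integral0_eq => s _; rewrite gamma_density_le0.
Qed.

Lemma measurable_esonine : measurable_fun [set: R] esonine.
Proof.
apply: (measurable_fun_fubini_tonelli_G (m1 := mu)
  (fun z : R * R => (p z.1 z.2)%:E)).
  by apply/measurable_EFinP; exact: measurable_gamma_density2.
by move=> z; rewrite lee_fin gamma_density_ge0.
Qed.

Lemma econv_esonineE (f : R -> \bar R) x :
  measurable_fun [set: R] f -> (forall y, 0 <= f y) ->
  econv f esonine x = \int[mu]_s econv f (EFin \o p s) x.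
Proof.
move=> mf f0; apply: (econv_integralr (g := fun s u => (p s u)%:E)) => //.
- by apply/measurable_EFinP; exact: measurable_gamma_density2.
- by move=> s u; rewrite lee_fin gamma_density_ge0.
Qed.

Lemma measurable_econv_density (f : R -> \bar R) x :
  measurable_fun [set: R] f -> (forall y, 0 <= f y) ->
  measurable_fun [set: R] (fun s => econv f (EFin \o p s) x).
Proof.
move=> mf f0; apply: (measurable_fun_fubini_tonelli_F (m2 := mu)
  (fun z : R * R => f (x - z.2)%R * (p z.1 z.2)%:E)).
  apply: emeasurable_funM; first exact: (measurableT_comp (measurable_subl x mf)).
  by apply/measurable_EFinP; exact: measurable_gamma_density2.
by move=> z; rewrite mule_ge0// lee_fin gamma_density_ge0.
Qed.

Lemma le_upper_gamma (r y z : R) : (0 < y <= z)%R ->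
  upper_gamma r z <= upper_gamma r y.
Proof.
move=> /andP[y0 yz]; have z0 := lt_le_trans y0 yz.
apply: ge0_le_integral => //.
- by move=> t _; exact: upper_integrand_ge0.
- exact: measurable_fun_pair2 (measurable_upper_integrand r).
- exact: measurable_fun_pair2 (measurable_upper_integrand r).
- move=> t _; rewrite !heaviside_pos// !mul1r lee_fin ler_wpM2r ?gamma_kernel_ge0//.
  rewrite /hv0 !subr_ge0; case: (leP z t) => zt //=.
  by rewrite (le_trans yz zt).
Qed.

Lemma upper_gamma_gt0 (r y : R) : (0 < y)%R -> 0 < upper_gamma r y.
Proof.
move=> y0; apply: (@integral_gt0_itv _ _ y (y + 1)); first by rewrite ltrDl.
- exact: measurable_fun_pair2 (measurable_upper_integrand r).
- by move=> t; exact: upper_integrand_ge0.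
- move=> t /andP[yt _]; rewrite lte_fin heaviside_pos// mul1r.
  rewrite /hv0 subr_ge0 (ltW yt) mul1r gamma_kernel_gt0//.
  exact: lt_trans yt.
Qed.

Lemma upper_gamma_lty (r y : R) : (0 < r)%R -> upper_gamma r y < +oo.
Proof.
move=> r0; apply: le_lt_trans (eGamma_lty r0); apply: ge0_le_integral => //.
- by move=> t _; exact: upper_integrand_ge0.
- exact: measurable_fun_pair2 (measurable_upper_integrand r).
- exact: measurable_EFin_gamma_kernel.
- move=> t _; rewrite lee_fin ler_piMl ?gamma_kernel_ge0//.
  by rewrite mulr_ile1 ?heaviside_ge0 ?heaviside0_ge0 ?heaviside_le1 ?heaviside0_le1.
Qed.

(** The renewal bound at r = 1 with c = U_1(x): as U_1 decreases, U_1(y) >= c for 0 < y <= x, so U_1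
    * g_s dominates c (H * g_s) at x. *)
Lemma integral_gamma_cdf_lty (x : R) : (0 < x)%R -> \int[mu]_s gamma_cdf s x < +oo.
Proof.
move=> x0; have mU := @measurable_upper_gamma R 1.
have U0 := @upper_gamma_ge0 R 1.
have := @upper_gamma_gt0 1 x x0; have := @upper_gamma_lty 1 x ltr01.
case E : (upper_gamma 1 x) => [c| |]// _; rewrite lte_fin => c0.
apply: (@integral_renewal R (fun s => gamma_cdf s x) (measurable_gamma_cdf x)
  (fun s => gamma_cdf_ge0 s x) (fun s => gamma_cdf_le1 s x)
  (fun s => @gamma_cdf_nparam R s x) 1 (Gamma 1)
  (fun s => econv (upper_gamma 1) (EFin \o p s) x) ltr01 (Gamma_gt0 ltr01)
  (measurable_econv_density x mU U0) _ _ c c0).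
- by move=> s; apply: econv_ge0 => // u; exact: EFin_gamma_density_ge0.
- by move=> s; have := econv_upper_gamma_density s x ltr01; rewrite -EFin_Gamma.
- move=> s; have mh := @measurable_EFin_heaviside R.
  have c0E : 0 <= c%:E by rewrite lee_fin ltW.
  rewrite /gamma_cdf -(@econvZl R c%:E _ _ x mh (measurable_gamma_density s)
    c0E (@EFin_heaviside_ge0 R) (EFin_gamma_density_ge0 s)).
  apply: le_econv => //.
  + exact: measurable_funeM.
  + exact: measurable_gamma_density.
  + by move=> y; rewrite mule_ge0 ?EFin_heaviside_ge0// lee_fin ltW.
  + by move=> y; exact: EFin_gamma_density_ge0.
  + move=> u; rewrite lte_fin => /gamma_density_gt0_arg u0 /=.
    have [xu|xu] := ltP 0%R (x - u)%R; last by rewrite heaviside_neg// mule0.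
    rewrite heaviside_pos// mule1 -E le_upper_gamma// xu/=.
    by rewrite gerBl ltW.
Qed.

Lemma econv_upper_esonine (r x : R) : (0 < r)%R -> (0 < x)%R ->
  econv (upper_gamma r) esonine x =
  (Gamma r)%:E * \int[mu]_s ((hv0 (r - s))%:E * gamma_cdf s x).
Proof.
move=> r0 x0; have mU := @measurable_upper_gamma R r.
have U0 := @upper_gamma_ge0 R r.
rewrite econv_esonineE//.
apply: (@integral_telescope R (fun s => gamma_cdf s x) (measurable_gamma_cdf x)
  (fun s => gamma_cdf_ge0 s x) r (Gamma r)
  (fun s => econv (upper_gamma r) (EFin \o p s) x) r0 (Gamma_gt0 r0)
  (measurable_econv_density x mU U0)).
- by move=> s; apply: econv_ge0 => // u; exact: EFin_gamma_density_ge0.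
- by move=> s; have := econv_upper_gamma_density s x r0; rewrite -EFin_Gamma.
- exact: integral_gamma_cdf_lty.
Qed.

(** Keep only 0 < t <= d, where e^(-t) >= e^(-d), and integrate t^(s-1) to d^s / s. The bound e^(-d)
    d^s tends to 1 as s -> 0 and then d -> 0. *)
Lemma gamma_cdf_ge (s x d : R) : (0 < s)%R -> (0 < d < x)%R ->
  (expR (- d + s * ln d))%:E <= (s * Gamma s)%:E * gamma_cdf s x.
Proof.
move=> s0 /andP[d0 dx].
have -> : (s * Gamma s)%:E * gamma_cdf s x =
    s%:E * econv (EFin \o hv) (EFin \o k s) x.
  rewrite EFinM -muleA; congr (_ * _).
  rewrite /gamma_cdf -(@econvZr R _ _ _ x (@measurable_EFin_heaviside R)
    (measurable_gamma_density s) _ (@EFin_heaviside_ge0 R)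
    (EFin_gamma_density_ge0 s)) ?lee_fin ?Gamma_ge0//.
  apply: eq_econvr => u; rewrite /= -EFinM; congr EFin.
  rewrite /gamma_density heaviside_pos// mul1r mulrC divfK//.
  by rewrite gt_eqF// Gamma_gt0.
apply: (@le_trans _ _ (s%:E * ((expR (- d))%:E * (d `^ s / s)%:E))).
  rewrite -!EFinM lee_fin /powR gt_eqF// expRD.
  set A := expR _; set B := expR _.
  by rewrite (_ : s * (A * (B / s)) = A * B)%R//; field; rewrite gt_eqF.
rewrite lee_pmul2l// -integral_pow_kernel// integral_mkcond.
have m1 : measurable_fun [set: R] ((fun t => (pow_kernel s t)%:E) \_ `]0%R, d]).
  apply/(measurable_restrictT _ _).1 => //; apply: measurable_funTS.
  by apply/measurable_EFinP; exact: measurable_pow_kernel.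
have e0 t : 0 <= ((fun t => (pow_kernel s t)%:E) \_ `]0%R, d]) t.
  by apply: erestrict_ge0 => u _; rewrite lee_fin pow_kernel_ge0.
rewrite -ge0_integralZl ?lee_fin ?expR_ge0//.
apply: ge0_le_integral => //.
- by move=> t _; rewrite mule_ge0// lee_fin expR_ge0.
- exact: measurable_funeM.
- apply: emeasurable_funM; last exact: measurable_EFin_gamma_kernel.
  exact: measurable_subl (@measurable_EFin_heaviside R).
- move=> t _; rewrite patchE mem_setE in_itv/= -EFinM.
  have kh0 : 0 <= (hv (x - t) * k s t)%:E.
    by rewrite lee_fin mulr_ge0 ?heaviside_ge0 ?gamma_kernel_ge0.
  case: ifPn => [/andP[t0 td]|_]; last by rewrite mule0.
  rewrite heaviside_pos ?subr_gt0 ?(le_lt_trans td)// mul1r -EFinM lee_fin.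
  by rewrite /k mulrC ler_wpM2l ?pow_kernel_ge0// ler_expR lerN2.
Qed.

End sonine.

(** * The limit r -> 0 in the convolution of U_r with the Sonine kernel *)

Section sonine_identity.
Context {R : realType}.
Local Notation mu := (@lebesgue_measure R).
Local Notation hv := (@heaviside R).
Local Notation hv0 := (@heaviside0 R).
Local Notation k := (@gamma_kernel R).
Local Notation U := (@upper_gamma R).
Local Open Scope ereal_scope.

Let mUi (r y : R) : measurable_fun [set: R]
  (fun t => (hv y * hv0 (t - y) * k r t)%:E).
Proof. exact: measurable_fun_pair2 (measurable_upper_integrand r). Qed.

Let Ui0 (r y t : R) : 0 <= (hv y * hv0 (t - y) * k r t)%:E.
Proof. exact: upper_integrand_ge0. Qed.

(** This is t^r <= 1 + r t multiplied by t^(-1) e^(-t). *)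
Lemma upper_gamma_le_E1 (r y : R) : (0 <= r <= 1)%R ->
  U r y <= U 0 y + r%:E * U 1 y.
Proof.
move=> r01; have /andP[r0 r1] := r01.
have r0E : 0 <= r%:E by rewrite lee_fin.
rewrite /U.
rewrite -(ge0_integralZl mu measurableT (mUi 1 y) (fun t _ => Ui0 1 y t) r0E).
have rU0 t : 0 <= r%:E * (hv y * hv0 (t - y) * k 1 t)%:E by exact: mule_ge0.
have mrU := measurable_funeM r%:E (mUi 1 y).
rewrite -(ge0_integralD mu measurableT (fun t _ => Ui0 0 y t) (mUi 0 y)
  (fun t _ => rU0 t) mrU).
apply: (ge0_le_integral mu measurableT (fun t _ => Ui0 r y t) (mUi r y)).
- exact: emeasurable_funD (mUi 0 y) mrU.
- move=> t _; rewrite -EFinM -EFinD lee_fin.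
  set w := (hv y * hv0 (t - y))%R.
  have w0 : (0 <= w)%R by rewrite mulr_ge0 ?heaviside_ge0 ?heaviside0_ge0.
  rewrite (mulrCA r) -mulrDr ler_wpM2l//.
  have [t0|t0] := ltP 0%R t; last by rewrite !gamma_kernel_le0// mulr0 addr0.
  rewrite /k mulrA -mulrDl ler_wpM2r ?expR_ge0//.
  rewrite /pow_kernel heaviside_pos// !mul1r.
  have -> : expR ((r - 1) * ln t) = (expR (r * ln t) * expR (- ln t))%R.
    by rewrite -expRD; congr expR; ring.
  have -> : expR ((0 - 1) * ln t) = expR (- ln t) by congr expR; ring.
  have -> : expR ((1 - 1) * ln t) = (expR (ln t) * expR (- ln t))%R.
    by rewrite -expRD; congr expR; ring.
  rewrite mulrA -[X in (_ <= X + _)%R]mul1r -mulrDl ler_wpM2r ?expR_ge0//.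
  exact: expR_chord.
Qed.

(** On the range of integration t >= y >= d, hence t^r >= d^r. *)
Lemma upper_gamma_ge_E1 (r y d : R) : (0 <= r)%R -> (0 < d <= y)%R ->
  (expR (r * ln d))%:E * U 0 y <= U r y.
Proof.
move=> r0 /andP[d0 dy]; have y0 := lt_le_trans d0 dy.
have e0 : 0 <= (expR (r * ln d))%:E by rewrite lee_fin expR_ge0.
rewrite /U.
rewrite -(ge0_integralZl mu measurableT (mUi 0 y) (fun t _ => Ui0 0 y t) e0).
have eU0 t : 0 <= (expR (r * ln d))%:E * (hv y * hv0 (t - y) * k 0 t)%:E.
  exact: mule_ge0.
apply: (ge0_le_integral mu measurableT (fun t _ => eU0 t)
  (measurable_funeM _ (mUi 0 y)) (mUi r y)).
- move=> t _; rewrite -EFinM lee_fin heaviside_pos// mul1r.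
  rewrite /hv0 subr_ge0; case: (leP y t) => yt; last by rewrite !mul0r mulr0.
  have t0 := lt_le_trans y0 yt.
  rewrite !mul1r /k mulrA ler_wpM2r ?expR_ge0//.
  rewrite /pow_kernel heaviside_pos// !mul1r -expRD ler_expR.
  have -> : ((r - 1) * ln t = r * ln t + (0 - 1) * ln t)%R by ring.
  rewrite lerD2r ler_wpM2l//.
  by rewrite ler_ln ?posrE// (le_trans dy).
Qed.

Let mU r := @measurable_upper_gamma R r.
Let U0 r y := @upper_gamma_ge0 R r y.
Let mS := @measurable_esonine R.
Let S0 := @esonine_ge0 R.

(** A distribution function is at most 1, so the convolution is at most r Gamma(r). *)
Lemma econv_upper_esonine_le (r x : R) : (0 < r <= 1)%R -> (0 < x)%R ->
  econv (U r) (@esonine R) x <= (1 + r)%:E.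
Proof.
move=> /[dup] r01 /andP[r0 r1] x0; rewrite econv_upper_esonine//.
apply: le_trans (eGamma_le r01); rewrite -EFin_Gamma// muleC.
apply: lee_wpmul2r; first by rewrite lee_fin Gamma_ge0.
exact: (@integral_below_le R (fun s => gamma_cdf s x) (measurable_gamma_cdf x)
  (fun s => gamma_cdf_ge0 s x) (fun s => gamma_cdf_le1 s x)
  (fun s => @gamma_cdf_nparam R s x) r (ltW r0)).
Qed.

(** Let q = e^(-d) d^r. For 0 < s <= r, [gamma_cdf_ge] and s Gamma(s) <= 1 + r bound the
    distribution function below by q / (1 + r); at s = r the same lemma gives r Gamma(r) >= q. The
    product is at least q^2, which is bounded below by its linearisation 1 + 2 (- d + r ln d). *)
Lemma econv_upper_esonine_ge (r d x : R) :
  (0 < r <= 1)%R -> (0 < d <= 1)%R -> (d < x)%R ->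
  (1 - 2 * d + 2 * (r * ln d))%:E <= (1 + r)%:E * econv (U r) (@esonine R) x.
Proof.
move=> /andP[r0 r1] /andP[d0 d1] dx; have x0 := lt_trans d0 dx.
have ddx : (0 < d < x)%R by rewrite d0.
have ld0 : (ln d <= 0)%R by rewrite ln_le0.
pose q : R := expR (- d + r * ln d).
have q0 : (0 <= q)%R by exact: expR_ge0.
have Gge (s : R) : (0 < s <= r)%R -> (q / (1 + r))%:E <= gamma_cdf s x.
  move=> /andP[s0 sr]; have s1 := le_trans sr r1.
  have r10 : (0 < 1 + r)%R by lra.
  rewrite EFinM muleC lee_pdivrMl//.
  apply: (@le_trans _ _ (expR (- d + s * ln d))%:E).
    by rewrite lee_fin ler_expR lerD2l ler_wnM2r.
  apply: le_trans (gamma_cdf_ge s0 ddx) _; apply: lee_wpmul2r.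
    exact: gamma_cdf_ge0.
  have s01 : (0 < s <= 1)%R by rewrite s0.
  have := eGamma_le s01; rewrite -EFin_Gamma// -EFinM => /le_trans; apply.
  by rewrite lee_fin lerD2l.
have Ige : (q / (1 + r) * r)%:E <=
    \int[mu]_s ((hv0 (r - s))%:E * gamma_cdf s x).
  have -> : (q / (1 + r) * r)%:E =
      \int[mu]_(s in `]0%R, r]) (q / (1 + r))%:E.
    rewrite integral_cst//= lebesgue_measure_itv/= lte_fin r0.
    by rewrite sube0.
  rewrite integral_mkcond; apply: ge0_le_integral => //.
  - move=> s _; apply: erestrict_ge0 => u _.
    by rewrite lee_fin divr_ge0// addr_ge0// ltW.
  - by apply/(measurable_restrictT _ _).1.
  - apply: emeasurable_funM; last exact: measurable_gamma_cdf.
    have mh : measurable_fun [set: R] (EFin \o hv0).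
      by apply/measurable_EFinP; exact: measurable_heaviside0.
    exact: measurable_subl mh.
  - move=> s _; rewrite patchE mem_setE in_itv/= /hv0 subr_ge0.
    case: ifPn => [sr|_].
      by have /andP[_ ->] := sr; rewrite mul1e Gge.
    by rewrite mule_ge0 ?lee_fin ?ler0n// gamma_cdf_ge0.
have rG : (q <= r * Gamma r)%R.
  rewrite -lee_fin; apply: le_trans (gamma_cdf_ge r0 ddx) _.
  rewrite -[leRHS]mule1 lee_wpmul2l ?gamma_cdf_le1// lee_fin.
  by rewrite mulr_ge0 ?Gamma_ge0// ltW.
rewrite econv_upper_esonine//.
apply: (@le_trans _ _ ((1 + r)%:E * ((Gamma r)%:E * (q / (1 + r) * r)%:E))); last first.
  by rewrite !lee_wpmul2l ?lee_fin ?Gamma_ge0// addr_ge0// ltW.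
rewrite -!EFinM lee_fin.
have -> : ((1 + r) * (Gamma r * (q / (1 + r) * r)) = q * (r * Gamma r))%R.
  by field; rewrite gt_eqF// ltr_wpDr// ltW.
apply: (@le_trans _ _ (q * q)%R); last by rewrite ler_wpM2l.
rewrite /q -expRD; apply: le_trans (expR_ge1Dx _).
lra.
Qed.

(** The bound U_r >= d^r U_0 fails near the singularity, so the integral is first restricted to x -
    u >= d. There r -> 0 yields the bound 1, and monotone convergence along d = 1/(n+1) recovers the
    whole integral. *)
Lemma econv_E1_esonine_le1 (x : R) : (0 < x)%R ->
  econv (U 0) (@esonine R) x <= 1.
Proof.
move=> x0; pose f u := U 0 (x - u)%R * esonine u.
have mf : measurable_fun [set: R] f.
  by apply: emeasurable_funM => //; exact: measurable_subl.
have f0 u : 0 <= f u by exact: mule_ge0.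
have trunc (d : R) : (0 < d)%R ->
    \int[mu]_(u in `]-oo, (x - d)%R]) f u <= 1.
  move=> d0; set V := \int[mu]_(u in _) f u.
  have V0 : 0 <= V by exact: integral_ge0.
  have Vr (r : R) : (0 < r <= 1)%R -> (expR (r * ln d))%:E * V <= (1 + r)%:E.
    move=> /[dup] r01 /andP[r0 r1].
    apply: le_trans (econv_upper_esonine_le r01 x0).
    have e0 : 0 <= (expR (r * ln d))%:E by rewrite lee_fin expR_ge0.
    have mD : measurable `]-oo, (x - d)%R]%classic by exact: measurable_itv.
    have mfD : measurable_fun `]-oo, (x - d)%R]%classic f.
      exact: measurable_funTS.
    rewrite /V -(ge0_integralZl mu mD mfD (fun u _ => f0 u) e0).
    rewrite /econv integral_mkcond; apply: (ge0_le_integral mu measurableT).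
    - by move=> u _; apply: erestrict_ge0 => v _; exact: mule_ge0.
    - apply/(measurable_restrictT _ _).1 => //; apply: measurable_funTS.
      exact: measurable_funeM.
    - by apply: emeasurable_funM => //; exact: measurable_subl.
    - move=> u _; rewrite patchE mem_setE in_itv/=.
      case: ifPn => [ux|_]; last exact: mule_ge0.
      rewrite /f muleA lee_wpmul2r// upper_gamma_ge_E1 ?(ltW r0)// d0/=.
      by rewrite lerBrDl -lerBrDr.
  have : V \is a fin_num.
    rewrite ge0_fin_numE// ltNge leye_eq; apply/negP => /eqP Voo.
    have := Vr 1%R; rewrite ltr01 lexx Voo => /(_ isT).
    by rewrite gt0_muley ?lte_fin ?expR_gt0// leye_eq.
  case: V V0 Vr => // v v0 Vr _; rewrite lee_fin in v0; rewrite lee_fin -subr_le0.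
  (* From (1 + r ln d) v <= d^r v <= 1 + r follows v - 1 <= r (1 - v ln d). *)
  apply: (@small_multiple_le0 _ _ 1 (1 - ln d * v)) => // r r01.
  have := Vr _ r01; rewrite -EFinM lee_fin.
  have := ler_wpM2r v0 (expR_ge1Dx (r * ln d)).
  set A := (expR _ * _)%R; nra.
pose D n : set R := `]-oo, (x - n.+1%:R^-1)%R]%classic.
have mD n : measurable (D n) by exact: measurable_itv.
have -> : econv (U 0) (@esonine R) x = \int[mu]_(u in \bigcup_n D n) f u.
  rewrite integral_mkcond; apply: eq_integral => u _; rewrite patchE.
  case: ifPn => // /negP ux; rewrite -/(f u) /f upper_gamma_le0 ?mul0e//.
  rewrite leNgt; apply/negP => xu; apply: ux; rewrite inE.
  have [n _ /(_ n (leqnn n)) nxu] := near_infty_natSinv_lt (PosNum xu).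
  by exists n => //; rewrite /D/= in_itv/= lerBrDl -lerBrDr; exact: ltW nxu.
have cvgV : \int[mu]_(u in D n) f u @[n --> \oo] -->
    \int[mu]_(u in \bigcup_n D n) f u.
  apply: ge0_nondecreasing_set_cvg_integral => //.
  - move=> m n mn; rewrite subsetEset => u; rewrite /D/= !in_itv/= => /le_trans.
    by apply; rewrite lerD2l lerN2 lef_pV2 ?posrE// ler_nat.
  - by move=> n; exact: measurable_funTS.
by apply: (cvge_le _ cvgV); apply: nearW => n; apply: trunc.
Qed.

Lemma econv_E1_esonine (x : R) : (0 < x)%R -> econv (U 0) (@esonine R) x = 1.
Proof.
move=> x0; pose V := econv (U 0) (@esonine R) x.
pose C := econv (U 1) (@esonine R) x.
have V1 : V <= 1 by exact: econv_E1_esonine_le1.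
suff : 1 <= V by move=> V1'; apply/le_anti; rewrite -/V V1 V1'.
have V0 : 0 <= V by exact: econv_ge0.
have C0 : 0 <= C by exact: econv_ge0.
have C1 : C <= (1 + 1)%:E.
  by apply: econv_upper_esonine_le; rewrite ?lexx ?ltr01.
have UrV (r : R) : (0 < r <= 1)%R ->
    econv (U r) (@esonine R) x <= V + r%:E * C.
  move=> /andP[r0 r1]; have r0E : 0 <= r%:E by rewrite lee_fin ltW.
  have rU0 y : 0 <= r%:E * U 1 y by exact: mule_ge0.
  have mrU := measurable_funeM r%:E (mU 1).
  rewrite -(@econvZl R _ _ _ x (mU 1) mS r0E (U0 1) S0).
  rewrite -(@econvDl R _ _ _ x (mU 0) mrU mS (U0 0) rU0 S0).
  apply: (le_econv (mU r) (emeasurable_funD (mU 0) mrU) mS (U0 r) S0) => u _.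
  by apply: upper_gamma_le_E1; rewrite (ltW r0).
move: (V) (C) V1 V0 C0 C1 UrV => [v| |]// [c| |]//.
rewrite !lee_fin => v1 v0 c0 c2 UrE; rewrite -subr_le0.
pose d0 : R := Num.min 1%R (x / 2)%R.
have d0_gt0 : (0 < d0)%R by rewrite lt_min ltr01 divr_gt0.
(* Two nested limits, r -> 0 at fixed d and then d -> 0; the constant 2 is the coefficient of d in
   [econv_upper_esonine_ge], and [d0] ensures d <= 1 and d < x. *)
apply: (@small_multiple_le0 _ _ d0 2) => // d /andP[dgt0].
rewrite le_min => /andP[d1 dx2].
have dx : (d < x)%R by lra.
(* The constant comes from 1 - 2d + 2 r ln d <= (1 + r)(v + r c) <= v + r v + 2 r c, using r^2 c <=
   r c. *)
rewrite -subr_le0; apply: (@small_multiple_le0 _ _ 1 (v + 2 * c - 2 * ln d)) => //.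
move=> r /[dup] r01 /andP[r0 r1].
have d01 : (0 < d <= 1)%R by rewrite dgt0.
have := econv_upper_esonine_ge r01 d01 dx.
have r10 : 0 <= (1 + r)%:E by rewrite lee_fin; lra.
move=> /le_trans /(_ (lee_wpmul2l r10 (UrE _ r01))).
rewrite [leRHS](_ : _ = ((1 + r) * (v + r * c))%R%:E)// lee_fin.
have rrc : (r * (r * c) <= r * c)%R by rewrite ler_wpM2l ?(ltW r0)// ler_piMl.
set L := ln d; lra.
Qed.

End sonine_identity.

(** * The kernels of the fractional operators *)

Section causal_kernels.
Context {R : realType}.
Local Notation mu := (@lebesgue_measure R).
Local Notation hv := (@heaviside R).
Local Notation hv0 := (@heaviside0 R).
Local Notation k := (@gamma_kernel R).

Definition causal (k0 : R -> R) (alpha y : R) : R := hv y * k0 (y / alpha).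

Local Open Scope ereal_scope.

(** Since 1/t <= 1/y on t >= y, U_0(y) is at most U_1(y) / y. *)
Lemma upper_gamma0_lty (y : R) : upper_gamma 0 y < +oo.
Proof.
have [y0|y0] := ltP 0%R y; last by rewrite upper_gamma_le0.
have yV0 : 0 <= (y^-1)%:E by rewrite lee_fin invr_ge0 ltW.
have mU1 : measurable_fun [set: R] (fun t => (hv y * hv0 (t - y) * k 1 t)%:E).
  exact: measurable_fun_pair2 (measurable_upper_integrand 1).
have mU0 : measurable_fun [set: R] (fun t => (hv y * hv0 (t - y) * k 0 t)%:E).
  exact: measurable_fun_pair2 (measurable_upper_integrand 0).
apply: (@le_lt_trans _ _ ((y^-1)%:E * upper_gamma 1 y)); last first.
  by rewrite lte_mul_pinfty ?fin_numE// upper_gamma_lty.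
rewrite /upper_gamma.
rewrite -(ge0_integralZl mu measurableT mU1
  (fun t _ => upper_integrand_ge0 1 y t) yV0).
apply: (ge0_le_integral mu measurableT (fun t _ => upper_integrand_ge0 0 y t)
  mU0 (measurable_funeM _ mU1)) => t _.
rewrite -EFinM lee_fin heaviside_pos// mul1r /hv0 subr_ge0.
case: (leP y t) => yt; last by rewrite !mul0r mulr0.
have t0 := lt_le_trans y0 yt.
rewrite !mul1r !gamma_kernelE// subrr powRr0 mul1r sub0r powR_inv1 ?(ltW t0)//.
by rewrite ler_wpM2r ?expR_ge0// lef_pV2 ?posrE.
Qed.

Lemma causal_expint1 (y : R) : (hv y * expint1 y)%:E = upper_gamma 0 y.
Proof.
have [y0|y0] := ltP 0%R y; last first.
  by rewrite heaviside_neg// mul0r upper_gamma_le0.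
rewrite heaviside_pos// mul1r -[RHS]fineK; last first.
  by rewrite ge0_fin_numE ?upper_gamma_ge0// upper_gamma0_lty.
rewrite /expint1 /Rintegral integral_mkcond; congr (fine _)%:E.
apply: eq_integral => t _; rewrite patchE mem_setE in_itv/= andbT.
rewrite heaviside_pos// mul1r /hv0 subr_ge0.
case: (leP y t) => yt /=; last by rewrite mul0r.
have t0 := lt_le_trans y0 yt.
by rewrite mul1r gamma_kernelE// sub0r powR_inv1 ?(ltW t0)// mulrC.
Qed.

(* [esonine u] is only shown to be finite for almost every [u]; where it is
   infinite both sides are the junk value 0 of [fine]. *)
Lemma causal_sonine (u : R) : (hv u * sonine_kernel u)%R = fine (esonine u).
Proof.
have [u0|u0] := ltP 0%R u; last by rewrite heaviside_neg// mul0r esonine_le0.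
rewrite heaviside_pos// mul1r /sonine_kernel /Rintegral.
have mp : measurable_fun [set: R] (fun s => (expR u * gamma_density s u)%:E).
  apply/measurable_EFinP; apply: measurable_funM => //.
  exact: measurable_fun_pair1 measurable_gamma_density2.
have p0 s : 0 <= (expR u * gamma_density s u)%:E.
  by rewrite lee_fin mulr_ge0 ?expR_ge0 ?gamma_density_ge0.
have -> : \int[mu]_(s in `]0%R, +oo[) (u `^ (s - 1) / Gamma s)%:E =
    \int[mu]_s (expR u * gamma_density s u)%:E.
  rewrite integral_mkcond; apply: eq_integral => s _.
  rewrite patchE mem_setE in_itv/= andbT.
  case: (ltP 0%R s) => s0 /=; last by rewrite gamma_density_nparam// mulr0.
  rewrite /gamma_density heaviside_pos// gamma_kernelE// mul1r; congr EFin.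
  by rewrite mulrA (mulrCA (expR u)) -expRD subrr expR0 mulr1.
have e0 : 0 <= (expR (- u))%:E by rewrite lee_fin expR_ge0.
have fineMl (c : R) (z : \bar R) : (0 < c)%R -> (c * fine z)%R = fine (c%:E * z).
  by move=> c0; case: z => [z| |]//=; rewrite ?(gt0_muley,gt0_muleNy) ?mulr0.
rewrite (fineMl _ _ (expR_gt0 _)).
rewrite -(ge0_integralZl mu measurableT mp (fun s _ => p0 s) e0).
congr fine; apply: eq_integral => s _; rewrite -EFinM mulrA -expRD.
by rewrite addNr expR0 mul1r.
Qed.

Lemma measurable_causal (k0 : R -> R) (alpha : R) : (0 < alpha)%R ->
  measurable_fun [set: R] (causal k0 1) ->
  measurable_fun [set: R] (causal k0 alpha).
Proof.
move=> alpha0 mk.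
rewrite (_ : causal k0 alpha = causal k0 1 \o (fun y => y / alpha)%R).
  apply: (measurableT_comp mk); exact: measurable_funM.
apply/funext => y; rewrite /causal /= divr1 /heaviside.
by rewrite pmulr_lgt0// invr_gt0.
Qed.

Lemma causal1E (k0 : R -> R) : causal k0 1 = (fun y => hv y * k0 y)%R.
Proof. by apply/funext => y; rewrite /causal divr1. Qed.

Lemma measurable_causal_expint1 (alpha : R) : (0 < alpha)%R ->
  measurable_fun [set: R] (causal expint1 alpha).
Proof.
move=> /measurable_causal; apply; rewrite causal1E.
apply/measurable_EFinP; rewrite (_ : EFin \o _ = upper_gamma 0).
  exact: measurable_upper_gamma.
by apply/funext => y; exact: causal_expint1.
Qed.

Lemma measurable_causal_sonine (alpha : R) : (0 < alpha)%R ->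
  measurable_fun [set: R] (causal sonine_kernel alpha).
Proof.
move=> /measurable_causal; apply; rewrite causal1E.
rewrite (_ : (fun y => _) = fine \o esonine).
  by apply: measurableT_comp => //; exact: measurable_esonine.
by apply/funext => y; exact: causal_sonine.
Qed.

Lemma causal_le0 (k0 : R -> R) (alpha y : R) : (y <= 0)%R ->
  causal k0 alpha y = 0%R.
Proof. by move=> y0; rewrite /causal heaviside_neg// mul0r. Qed.

Lemma causal_dilate (k0 : R -> R) (alpha y : R) : (0 < alpha)%R ->
  causal k0 alpha (alpha * y) = causal k0 1 y.
Proof.
move=> alpha0; rewrite /causal divr1 /heaviside pmulr_rgt0//.
by rewrite mulrAC mulfV ?mul1r// gt_eqF.
Qed.

Lemma causal_expint1_gt0 (alpha y : R) : (0 < alpha)%R -> (0 < y)%R ->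
  (0 < causal expint1 alpha y)%R.
Proof.
move=> alpha0 y0; have ya : (0 < y / alpha)%R by rewrite divr_gt0.
rewrite -lte_fin /causal heaviside_pos// -(heaviside_pos ya) causal_expint1.
exact: upper_gamma_gt0.
Qed.

Lemma causal_expint1_ge0 (alpha y : R) : (0 < alpha)%R ->
  (0 <= causal expint1 alpha y)%R.
Proof.
move=> alpha0; have [y0|y0] := ltP 0%R y; last by rewrite causal_le0.
by rewrite ltW// causal_expint1_gt0.
Qed.

Lemma causal_sonine_ge0 (alpha y : R) : (0 < alpha)%R ->
  (0 <= causal sonine_kernel alpha y)%R.
Proof.
move=> alpha0; have [y0|y0] := ltP 0%R y; last by rewrite causal_le0.
have ya : (0 < y / alpha)%R by rewrite divr_gt0.
rewrite /causal heaviside_pos// -(heaviside_pos ya) causal_sonine.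
by rewrite fine_ge0// esonine_ge0.
Qed.

(** The extended integral equals 1, so its integrand is finite for almost every u. For u < x the
    factor U_0(x-u) is positive and finite, which forces [esonine u] to be finite there; replacing
    it by its real value then changes nothing. *)
Lemma econv_causal1 (x : R) : (0 < x)%R ->
  econv (EFin \o causal expint1 1) (EFin \o causal sonine_kernel 1) x = 1.
Proof.
move=> x0; have mU := @measurable_upper_gamma R 0; have mS := @measurable_esonine R.
have U0 := @upper_gamma_ge0 R 0; have S0 := @esonine_ge0 R.
rewrite -(econv_E1_esonine x0).
have mUS : measurable_fun [set: R] (fun u => upper_gamma 0 (x - u) * esonine u).
  by apply: emeasurable_funM => //; exact: measurable_subl.
have US0 u : 0 <= upper_gamma 0 (x - u) * esonine u by exact: mule_ge0.
have mES : measurable_fun [set: R] (fun u : R =>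
    (EFin \o causal expint1 1) (x - u)%R * (EFin \o causal sonine_kernel 1) u).
  apply: emeasurable_funM.
    apply: measurable_subl; apply/measurable_EFinP.
    exact: measurable_causal_expint1.
  by apply/measurable_EFinP; exact: measurable_causal_sonine.
have /integrable_ae /= USae : mu.-integrable [set: R]
    (fun u => upper_gamma 0 (x - u) * esonine u).
  apply/integrableP; split => //.
  under eq_integral do rewrite gee0_abs//.
  by rewrite [X in X < _](econv_E1_esonine x0) ltry.
apply: ae_eq_integral => //; have := USae measurableT.
apply: filterS => u /= /(_ I) + _.
rewrite !causal1E causal_expint1 causal_sonine.
case: (ltP 0%R (x - u)%R) => xu; last by rewrite upper_gamma_le0// !mul0e.
have := upper_gamma_gt0 0 xu; have := upper_gamma0_lty (x - u)%R.
case: (upper_gamma 0 (x - u)) => // c _ c0.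
have := S0 u; case: (esonine u) => //= _.
by rewrite gt0_muley.
Qed.

(** Dilation by alpha reduces to the unscaled kernels; the Jacobian alpha is what the prefactor of
    [frac_J] cancels. *)
Lemma econv_causal (alpha x : R) : (0 < alpha)%R ->
  econv (EFin \o causal expint1 alpha) (EFin \o causal sonine_kernel alpha) x =
  (alpha * hv x)%:E.
Proof.
move=> alpha0; have mE := measurable_causal_expint1 alpha0.
have mS := measurable_causal_sonine alpha0.
have [x0|x0] := ltP 0%R x; last first.
  rewrite heaviside_neg// mulr0; apply: integral0_eq => u _ /=.
  have [u0|u0] := ltP 0%R u; last by rewrite [causal _ _ u]causal_le0// mule0.
  by rewrite causal_le0 ?mul0e// subr_le0 (le_trans x0)// ltW.
have xa : (0 < x / alpha)%R by rewrite divr_gt0.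
pose f u := (EFin \o causal expint1 alpha) (x - u)%R *
  (EFin \o causal sonine_kernel alpha) u.
have mf : measurable_fun [set: R] f.
  apply: emeasurable_funM; last exact/measurable_EFinP.
  by apply: measurable_subl; exact/measurable_EFinP.
have f0 u : 0 <= f u.
  rewrite /f /= -EFinM lee_fin mulr_ge0 ?causal_expint1_ge0//.
  exact: causal_sonine_ge0.
have fE v : f (alpha * v)%R = (EFin \o causal expint1 1) (x / alpha - v)%R *
    (EFin \o causal sonine_kernel 1) v.
  rewrite /f /= (_ : x - alpha * v = alpha * (x / alpha - v))%R.
    by rewrite !causal_dilate.
  by rewrite mulrBr mulrCA mulfV ?mulr1// gt_eqF.
rewrite heaviside_pos// mulr1.
transitivity (alpha%:E * \int[mu]_v f (alpha * v)%R).
  exact: esym (ge0_integral_dilate alpha0 mf f0).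
rewrite -[RHS]mule1 -(econv_causal1 xa).
by apply: (congr1 (fun z => alpha%:E * z)); apply: eq_integral => v _; exact: fE.
Qed.

End causal_kernels.

(** * Derivatives of primitives *)

Section measurable_derivative.
Context {R : realType}.
Variable g : R -> R.
Hypothesis cg : continuous g.

Let slope (h x : R) : R := h^-1 * (g (h + x) - g x).

Let continuous_slope h : continuous (slope h).
Proof.
move=> x; apply: cvgM; first exact: cvg_cst.
apply: cvgB; last exact: cg.
apply: (@continuous_comp _ _ _ (fun y : R => h + y) g); last exact: cg.
by apply: cvgD => //; exact: cvg_cst.
Qed.

Let continuous_slope_step x h : h != 0 -> {for h, continuous (slope ^~ x)}.
Proof.
move=> h0; apply: cvgM; first exact: cvgV.
apply: cvgB; last exact: cvg_cst.
apply: (@continuous_comp _ _ _ (fun y : R => y + x) g); last exact: cg.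
by apply: cvgD => //; exact: cvg_cst.
Qed.

Let derivableE x : derivable g x 1 <-> cvg (slope h x @[h --> 0^']).
Proof.
rewrite /derivable.
suff -> : (fun h => h^-1 *: (g (h *: 1 + x) - g x)) = slope ^~ x by [].
by apply/funext => h; rewrite /slope /GRing.scale /= mulr1.
Qed.

(** The reference increment 1/(n+2) lies inside the ball of radius 1/(n+1). Comparing with one fixed
    quotient makes each such set closed. *)
Let near_slope (m n : nat) (q : rat) : set R :=
  [set x | 0 < `|ratr q : R| < n.+1%:R^-1 ->
    `|slope (ratr q) x - slope n.+2%:R^-1 x| <= m.+1%:R^-1].

(* Cauchy criterion for the difference quotients; by continuity of g rational
   increments suffice, so the set is Borel. *)
Let slope_cauchy : set R :=
  \bigcap_m \bigcup_n \bigcap_(q in [set: rat]) near_slope m n q.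

Let measurable_slope_cauchy : measurable slope_cauchy.
Proof.
apply: bigcapT_measurable => m; apply: bigcupT_measurable => n.
rewrite -[X in measurable X]setCK; apply: measurableC; rewrite setC_bigcap.
apply: bigcupT_measurable_rat => q; apply: measurableC; rewrite /near_slope.
case: (boolP (0 < `|ratr q : R| < n.+1%:R^-1)) => [qn|_]; last first.
  by rewrite [X in measurable X](_ : _ = setT)//; apply/seteqP; split.
apply: closed_measurable.
have -> : [set x | true -> `|slope (ratr q) x - slope n.+2%:R^-1 x| <= m.+1%:R^-1] =
    (fun x => `|slope (ratr q) x - slope n.+2%:R^-1 x|) @^-1` `]-oo, m.+1%:R^-1].
  by apply/seteqP; split => x /=; rewrite in_itv//= => /(_ isT).
apply: closed_comp => [x _|]; last exact: interval_closed.
apply: cvg_norm; apply: cvgB; exact: continuous_slope.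
Qed.

Let slope_cauchyP x : slope_cauchy x <-> derivable g x 1.
Proof.
rewrite derivableE; split.
  move=> sx; apply/cauchy_cvgP; apply: cauchy_exP => e e0.
  have [m _ /(_ m (leqnn m)) /= me] := near_infty_natSinv_lt (PosNum e0).
  have [n _ nP] := sx m I; exists (slope n.+2%:R^-1 x).
  have n0 : 0 < n.+1%:R^-1 :> R by rewrite invr_gt0.
  apply/nbhs_ballP; exists n.+1%:R^-1 => //= h.
  rewrite /ball/= sub0r normrN => hn h0.
  rewrite /ball/= distrC; apply: le_lt_trans me.
  rewrite leNgt; apply/negP => lth.
  (* A violation at a real increment h persists on a neighbourhood of h, hence occurs at a rational
     increment. *)
  pose A : set R := [set q | (0 < `|q| < n.+1%:R^-1) &&
    (m.+1%:R^-1 < `|slope q x - slope n.+2%:R^-1 x|)].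
  have [r r0 rA] : exists2 r : R, 0 < r & ball h r `<=` A.
    suff : nbhs h A by move=> /nbhs_ballP[r r0 rA]; exists r.
    have cabs : `|q| @[q --> h] --> `|h| by exact: cvg_norm.
    have csl : `|slope q x - slope n.+2%:R^-1 x| @[q --> h] -->
        `|slope h x - slope n.+2%:R^-1 x|.
      apply: cvg_norm; apply: cvgB; last exact: cvg_cst.
      exact: continuous_slope_step.
    have h0' : 0 < `|h| by rewrite normr_gt0.
    near=> q; apply/andP; split; first (apply/andP; split).
    - by near: q; exact: (cvgr_gt _ cabs).
    - by near: q; exact: (cvgr_lt _ cabs).
    - by near: q; exact: (cvgr_gt _ csl).
  have /rat_in_itvoo[q] : h < h + r by rewrite ltrDl.
  rewrite in_itv/= => /andP[hq qr].
  have /rA/andP[qn] : ball h r (ratr q : R).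
    by rewrite /ball/= ltr_distlC qr andbT (lt_trans _ hq)// ltrBlDr ltrDl.
  by rewrite ltNge nP.
move=> /cauchy_cvgP /cauchyP cx m _.
have m0 : 0 < (2 * m.+1%:R)^-1 :> R by rewrite invr_gt0 mulr_gt0.
have [l /nbhs_ballP[d /= d0 dl]] := cx _ m0.
have [n _ /(_ n (leqnn n)) /= nd] := near_infty_natSinv_lt (PosNum d0).
exists n => // q _ /andP[q0 qn].
have n2 : 0 < n.+2%:R^-1 :> R by rewrite invr_gt0.
have n2n : n.+2%:R^-1 < n.+1%:R^-1 :> R by rewrite ltf_pV2 ?posrE// ltr_nat.
have := dl (ratr q); rewrite /ball/= sub0r normrN => /(_ (lt_trans qn nd)).
have := dl n.+2%:R^-1; rewrite /ball/= sub0r normrN gtr0_norm//.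
move=> /(_ (lt_trans n2n nd)) /(_ (lt0r_neq0 n2)) h1.
rewrite -normr_gt0 => /(_ q0) h2.
have -> : m.+1%:R^-1 = (2 * m.+1%:R)^-1 + (2 * m.+1%:R)^-1 :> R.
  have : m.+1%:R != 0 :> R by rewrite pnatr_eq0.
  by move: (m.+1%:R : R) => M M0; field.
rewrite distrC in h2.
apply: le_trans (ler_distD l _ _) _.
by apply: lerD; apply: ltW.
Unshelve. all: by end_near. Qed.

(** Needed because [L1] asks for Borel measurability, which does not pass to functions that are
    merely equal almost everywhere. *)
Lemma measurable_derive1 : measurable_fun [set: R] (derive1 g).
Proof.
have mD := measurable_slope_cauchy.
have derE x : derive1 g x = lim (slope h x @[h --> 0^']) by [].
rewrite -(setvU slope_cauchy); apply/measurable_funU => //.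
  exact: measurableC.
split.
  (* Where the difference quotients diverge, [lim] returns the default [point], so the derivative is
     constant on this set. *)
  apply: (eq_measurable_fun (fun=> point)); last exact: measurable_cst.
  move=> x /[!inE] xD; apply/esym; rewrite derE; apply: dvgP.
  by move=> c; apply: xD; exact: (slope_cauchyP x).2 ((derivableE x).2 c).
apply: (measurable_fun_cvg (h := fun n x => slope n.+1%:R^-1 x)) => //.
- move=> n; apply: measurable_funTS; apply: continuous_measurable_fun.
  exact: continuous_slope.
- move=> x /slope_cauchyP /derivableE; rewrite derE.
  move=> /(cvgr_dnbhsP _ _ _).1 /(_ (fun n => n.+1%:R^-1)); apply.
  by split => [n|]; [rewrite gt_eqF|exact: cvg_harmonic].
Qed.

End measurable_derivative.

(** * Absolutely continuous functions and primitives *)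

Section absolute_continuity.
Context {R : realType}.
Local Notation mu := (@lebesgue_measure R).

Lemma absolutely_continuous_dist (a b : R) (g : R -> R) :
  absolutely_continuous a b g -> forall e, 0 < e ->
  exists2 d, 0 < d & forall y z, a <= y <= b -> a <= z <= b ->
    `|z - y| < d -> `|g z - g y| < e.
Proof.
move=> acg e e0; have [d d0 gd] := acg _ e0; exists d => //.
have step y z : a <= y -> y <= z -> z <= b -> z - y < d -> `|g z - g y| < e.
  move=> ay yz zb zyd.
  have := gd 1%N (fun=> y) (fun=> z); rewrite !big_ord1; apply => //.
  by move=> i j _ _ _; rewrite !ord1.
move=> y z /andP[ay yb] /andP[az zb].
have [yz|/ltW zy] := leP y z; first by rewrite ger0_norm ?subr_ge0//; exact: step.
by rewrite distrC (distrC (g z)) ger0_norm ?subr_ge0//; exact: step.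
Qed.

(** If g and h differed at x, by continuity they would differ on an interval of positive length next
    to x, taken to the right when x < b and to the left when x = b so that it stays in [a, b]. *)
Lemma ae_eq_absolutely_continuous (a b : R) (g h : R -> R) : a < b ->
  absolutely_continuous a b g -> absolutely_continuous a b h ->
  ae_eq mu `[a, b]%classic g h -> forall x, a <= x <= b -> g x = h x.
Proof.
move=> ab acg ach gh x xab; apply/eqP; rewrite -subr_eq0; apply/negP => /negP.
rewrite -normr_gt0; set e := `|g x - h x| => e0.
have e20 : 0 < e / 2 by rewrite divr_gt0.
have [d1 d10 gd] := absolutely_continuous_dist acg e20.
have [d2 d20 hd] := absolutely_continuous_dist ach e20.
have [l [r [lr lrab lrd]]] : exists l r : R, [/\ l < r,
    (forall y, l < y < r -> a <= y <= b) &
    (forall y, l < y < r -> `|y - x| < Num.min d1 d2)].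
  have m0 : 0 < Num.min d1 d2 by rewrite lt_min d10.
  have /andP[ax xb] := xab.
  have [xb'|bx] := ltP x b.
    exists x, (Num.min b (x + Num.min d1 d2)); split => [|y|y].
    - by rewrite lt_min xb' ltrDl.
    - rewrite lt_min => /and3P[xy yb _].
      by rewrite (le_trans ax (ltW xy)) ltW.
    - rewrite lt_min => /and3P[xy _ yd].
      by rewrite gtr0_norm ?subr_gt0// ltrBlDl.
  exists (Num.max a (x - Num.min d1 d2)), x; split => [|y|y].
  - by rewrite gt_max (lt_le_trans ab bx) ltrBlDr ltrDl.
  - rewrite gt_max => /andP[/andP[ay _] yx].
    by rewrite ltW// (le_trans (ltW yx)).
  - rewrite gt_max => /andP[/andP[_ yd] yx].
    by rewrite ltr0_norm ?subr_lt0// opprB ltrBlDl -ltrBlDr.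
move: gh => [N [mN N0 ghN]].
have : (mu `]l, r[%classic <= mu N)%E.
  apply: le_measure; rewrite ?inE//= => y/=; rewrite in_itv/= => lyr.
  apply: ghN => /= ghy.
  have yab := lrab _ lyr; have := lrd _ lyr; rewrite lt_min => /andP[yd1 yd2].
  have := ghy; rewrite in_itv/= => /(_ yab) gyhy.
  have := gd x y xab yab yd1; have := hd x y xab yab yd2; rewrite gyhy => hh gg.
  have : e < e / 2 + e / 2.
    rewrite {1}/e; apply: le_lt_trans (ler_distD (h y) _ _) _.
    by rewrite ltrD// distrC.
  by rewrite -splitr ltxx.
rewrite N0 lebesgue_measure_itv/= lte_fin lr -EFinB lee_fin subr_le0.
by rewrite leNgt lr.
Qed.

Variable phi : R -> R.
Hypothesis iphi : mu.-integrable [set: R] (EFin \o phi).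

(** Applied to functions extended by 0 outside [a, b], for which it coincides with the primitive
    based at a. *)
Definition primitive (x : R) : R := \int[mu]_(t in `]-oo, x]) phi t.

Let iphiS (D : set R) : measurable D -> mu.-integrable D (EFin \o phi).
Proof. by move=> mD; exact: integrableS iphi. Qed.

(** Absolute continuity of the integral of |phi|, applied to the union of the disjoint intervals,
    whose measure is the sum of the lengths. *)
Lemma absolutely_continuous_primitive (a b : R) :
  absolutely_continuous a b primitive.
Proof.
move=> e e0; have [d [d0 small]] := integral_normr_continuous iphi e0.
exists d => // n l r lr tr lrd.
pose I (i : 'I_n) : set R := `]l i, r i[%classic.
have mI i : measurable (I i) by exact: measurable_itv.
pose D := \big[setU/set0]_(i < n) I i.
have mD : measurable D by exact: bigsetU_measurable.
have muD : (mu D < d%:E)%E.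
  rewrite /D measure_bigsetU_ord//.
  rewrite (eq_bigr (fun i => (r i - l i)%:E)) ?sumEFin ?lte_fin// => i _.
  have [_ [lri _]] := lr i.
  rewrite /= lebesgue_measure_itv/= lte_fin; case: ltP => // rl.
  by congr EFin; apply/esym/eqP; rewrite subr_eq0 eq_le lri rl.
apply: le_lt_trans (small D mD muD).
have iabs (A : set R) : measurable A ->
    mu.-integrable A (EFin \o (fun t => `|phi t|)).
  by move=> mA; have := integrable_abse (iphiS mA).
have -> : \int[mu]_(t in D) `|phi t| = \sum_(i < n) \int[mu]_(t in I i) `|phi t|.
  apply: EFin_inj; rewrite -sumEFin /Rintegral [LHS]fineK; last first.
    by apply: integrable_fin_num; [exact: mD|exact: iabs].
  rewrite ge0_integral_bigsetU ?index_enum_uniq//=.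
  - apply: eq_bigr => i _; rewrite fineK//.
    by apply: integrable_fin_num; [exact: mI|exact: iabs].
  - exact: sub_trivIset tr.
  - by apply: measurable_funTS; have /measurable_int := iabs _ (@measurableT _ R).
apply: ler_sum => i _; have [_ [lri _]] := lr i.
have -> : primitive (r i) - primitive (l i) = \int[mu]_(t in `]l i, r i]) phi t.
  by rewrite /primitive Rintegral_itvB//; exact: iphiS.
rewrite -Rintegral_itv_bndo_bndc; last exact: iphiS.
by apply: le_normr_Rintegral => //; exact: iphiS.
Qed.

Lemma continuous_primitive : continuous primitive.
Proof.
move=> x; apply/cvgrPdist_lt => e e0.
have [d d0 gd] := absolutely_continuous_dist
  (@absolutely_continuous_primitive (x - 1) (x + 1)) e0.
near=> y; rewrite distrC; apply: gd.
- by rewrite lerBlDr !lerDl ler01.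
- by rewrite -ler_distlC; near: y; apply: cvgr_dist_le => //; exact: cvg_id.
- by rewrite distrC; near: y; apply: cvgr_dist_lt => //; exact: cvg_id.
Unshelve. all: by end_near. Qed.

Lemma ae_derive_primitive :
  {ae mu, forall x, derivable primitive x 1 /\ derive1 primitive x = phi x}.
Proof.
apply: FTC1Ny; first by move=> y; exact: iphiS.
by apply: open_integrable_locally => //; exact: openT.
Qed.

End absolute_continuity.

(** * Fractional integral and derivative *)

Section fractional_operators.
Context {R : realType}.
Local Notation mu := (@lebesgue_measure R).
Local Notation hv := (@heaviside R).
Variables (alpha a b : R).
Hypothesis alpha0 : 0 < alpha.
Local Notation E1 := (causal (@expint1 R) alpha).
Local Notation S1 := (causal (@sonine_kernel R) alpha).

Let mE1 : measurable_fun [set: R] E1.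
Proof. exact: measurable_causal_expint1. Qed.

Let mS1 : measurable_fun [set: R] S1.
Proof. exact: measurable_causal_sonine. Qed.

Let E1_ge0 y : 0 <= E1 y. Proof. exact: causal_expint1_ge0. Qed.

Let S1_ge0 y : 0 <= S1 y. Proof. exact: causal_sonine_ge0. Qed.

Let measurable_revr (k : R -> R) x : measurable_fun [set: R] k ->
  measurable_fun [set: R] (fun t : R => k (x - t)).
Proof. by move=> mk; apply: (measurableT_comp mk); exact: measurable_funB. Qed.

(** Common bridge from [frac_J] and [frac_S] to whole-line convolutions. *)
Lemma Rintegral_causal (k0 q : R -> R) (x : R) : x <= b ->
  measurable_fun [set: R] (causal k0 alpha) ->
  measurable_fun [set: R] (q \_ `[a, b]) ->
  \int[mu]_(t in `[a, x]) (k0 ((x - t) / alpha) * q t) =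
  fine (\int[mu]_t (causal k0 alpha (x - t) * (q \_ `[a, b]) t)%:E).
Proof.
move=> xb mk mq.
have mkq : measurable_fun [set: R]
    (fun t => (causal k0 alpha (x - t) * (q \_ `[a, b]) t)%:E).
  apply/measurable_EFinP; apply: measurable_funM => //.
  exact: measurable_revr mk.
have kqE t : a <= t -> t < x ->
    causal k0 alpha (x - t) * (q \_ `[a, b]) t = k0 ((x - t) / alpha) * q t.
  move=> at_ tx; rewrite /causal heaviside_pos ?subr_gt0// mul1r patchE ifT//.
  by rewrite mem_setE in_itv/= at_ (le_trans (ltW tx)).
(* The endpoint t = x is dropped: there the cut-off kernel is 0, whereas [k0 0] is arbitrary. *)
rewrite /Rintegral -integral_itv_bndo_bndc; last first.
  apply: eq_measurable_fun (measurable_funTS mkq) => t.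
  by rewrite inE/= in_itv/= => /andP[at_ tx]; rewrite kqE.
congr fine; rewrite integral_mkcond; apply: eq_integral => t _.
rewrite patchE mem_setE in_itv/=; case: ifPn => [/andP[at_ tx]|].
  by rewrite kqE.
rewrite negb_and -ltNge -leNgt => /orP[ta|xt].
  by rewrite patchE ifF ?mulr0// mem_setE in_itv/= leNgt ta.
by rewrite causal_le0 ?mul0r// subr_le0.
Qed.

Variables (f phi : R -> R).
Hypotheses (iphi : L1 a b phi) (iL1f : L1 a b f).
Hypothesis fE : ae_eq mu `[a, b]%classic f (frac_S a alpha phi).
Local Notation phib := (phi \_ `[a, b]).
Local Notation fb := (f \_ `[a, b]).

Let L1_patch (q : R -> R) : L1 a b q ->
  mu.-integrable [set: R] (EFin \o (q \_ `[a, b])).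
Proof.
move=> iq; rewrite -restrict_EFin; apply/(integrable_mkcond _ _).1 => //.
Qed.

Let iphib : mu.-integrable [set: R] (EFin \o phib). Proof. exact: L1_patch. Qed.

Let mphib : measurable_fun [set: R] phib.
Proof. by apply/measurable_EFinP; exact: measurable_int iphib. Qed.

Let mfb : measurable_fun [set: R] fb.
Proof. by apply/measurable_EFinP; exact: measurable_int (L1_patch iL1f). Qed.

Lemma integral_shifted_kernels (x t : R) :
  (\int[mu]_tau (E1 (x - tau) * S1 (tau - t))%:E = (alpha * hv (x - t))%:E)%E.
Proof.
rewrite -(econv_causal (x - t) alpha0).
rewrite -(@ge0_integral_shift R (fun tau => (E1 (x - tau) * S1 (tau - t))%:E) t).
- apply: eq_integral => v _; rewrite /= EFinM addrK.
  by congr ((E1 _)%:E * _)%E; ring.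
- apply/measurable_EFinP; apply: measurable_funM; first exact: measurable_revr.
  by apply: (measurableT_comp mS1); exact: measurable_funB.
- by move=> tau; rewrite lee_fin mulr_ge0.
Qed.

Let K x (z : R * R) : R := E1 (x - z.1) * (S1 (z.1 - z.2) * phib z.2).

Let mK x : measurable_fun [set: R * R] (EFin \o K x).
Proof.
apply/measurable_EFinP; apply: measurable_funM.
  by apply: (measurableT_comp mE1); exact: measurable_funB.
apply: measurable_funM; last exact: measurableT_comp.
by apply: (measurableT_comp mS1); exact: measurable_funB.
Qed.

Let mES x t : measurable_fun [set: R] (fun tau => (E1 (x - tau) * S1 (tau - t))%:E).
Proof.
apply/measurable_EFinP; apply: measurable_funM; first exact: measurable_revr.
by apply: (measurableT_comp mS1); exact: measurable_funB.
Qed.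

Let ES0 x t tau : (0 <= (E1 (x - tau) * S1 (tau - t))%:E)%E.
Proof. by rewrite lee_fin mulr_ge0. Qed.

(** Integrating |K| in tau first, Sonine's identity gives exactly alpha H(x-t) |phi(t)|, which is
    integrable in t. *)
Let iK x : (mu \x mu)%E.-integrable [set: R * R] (EFin \o K x).
Proof.
apply/(integrable21ltyP mu mu (mK x)).
have -> : (fun t => \int[mu]_tau `|(EFin \o K x) (tau, t)|)%E =
    (fun t => (alpha * hv (x - t))%:E * `|(phib t)%:E|)%E.
  apply/funext => t; rewrite -integral_shifted_kernels.
  rewrite -(ge0_integralZr mu measurableT (mES x t) (fun tau _ => ES0 x t tau))//.
  apply: eq_integral => tau _ /=; rewrite -EFinM /K /= mulrA normrM.
  by rewrite ger0_norm// mulr_ge0.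
have /integrableP[_ ioo] := integrableZl measurableT alpha iphib.
apply: le_lt_trans ioo; apply: ge0_le_integral => //.
- by move=> t _; rewrite mule_ge0// lee_fin mulr_ge0 ?heaviside_ge0// ltW.
- apply: emeasurable_funM.
    apply/measurable_EFinP; apply: measurable_funM => //.
    exact: measurable_revr (@measurable_heaviside R).
  by apply: measurableT_comp => //; exact/measurable_EFinP.
- apply: measurableT_comp => //; apply: measurable_funeM.
  exact/measurable_EFinP.
- move=> t _; rewrite abseM lee_wpmul2r//= lee_fin gtr0_norm//.
  by rewrite ger_pMr// heaviside_le1.
Qed.

Let Fubini_primitive (x : R) :
  (\int[mu]_t \int[mu]_tau (EFin \o K x) (tau, t) =
   (alpha * primitive phib x)%:E)%E.
Proof.
have inner t : (\int[mu]_tau (EFin \o K x) (tau, t) =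
    alpha%:E * (EFin \o (phib \_ `]-oo, x[)) t)%E.
  have iES : mu.-integrable [set: R] (fun tau => (E1 (x - tau) * S1 (tau - t))%:E).
    apply/integrableP; split; first exact: mES.
    under eq_integral => tau _ do rewrite gee0_abs ?ES0//.
    by rewrite integral_shifted_kernels ltry.
  transitivity (\int[mu]_tau ((phib t)%:E * (E1 (x - tau) * S1 (tau - t))%:E))%E.
    by apply: eq_integral => tau _; rewrite -EFinM /K /= mulrA mulrC.
  rewrite integralZl// integral_shifted_kernels -!EFinM /=; congr EFin.
  rewrite [in RHS]patchE mem_setE in_itv/=; have [tx|xt] := ltP t x.
    by rewrite heaviside_pos ?subr_gt0// mulr1 mulrC.
  by rewrite heaviside_neg ?subr_le0// !mulr0.
have iphibx : mu.-integrable `]-oo, x[ (EFin \o phib).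
  by apply: integrableS iphib.
transitivity (\int[mu]_t (alpha%:E * (EFin \o (phib \_ `]-oo, x[)) t))%E.
  by apply: eq_integral => t _; exact: inner.
rewrite integralZl//; last first.
  by rewrite -restrict_EFin; apply/(integrable_mkcond _ _).1.
rewrite -restrict_EFin -integral_mkcond EFinM; congr (_ * _)%E.
rewrite /primitive -Rintegral_itv_bndo_bndc// /Rintegral fineK//.
by apply: integrable_fin_num.
Qed.

(** Fubini exchanges the two integrals. The value of [frac_S] at tau is a genuine integral only if t
    -> S(tau-t) phi(t) is integrable, which holds for almost every tau < x; this suffices under the
    outer integral, and the identity holds at every x of [a, b]. *)
Lemma frac_JE (x : R) : a <= x <= b -> frac_J a alpha f x = primitive phib x.
Proof.
move=> /andP[ax xb].
have -> : frac_J a alpha f x =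
    alpha^-1 * fine (\int[mu]_t (E1 (x - t) * fb t)%:E).
  by rewrite /frac_J Rintegral_causal.
suff -> : (\int[mu]_t (E1 (x - t) * fb t)%:E = (alpha * primitive phib x)%:E)%E.
  by rewrite /= mulrA mulVf ?mul1r// gt_eqF.
have := Fubini (iK x).
have -> : (\int[mu]_t \int[mu]_tau (EFin \o K x) (tau, t) =
    (alpha * primitive phib x)%:E)%E by exact: Fubini_primitive.
move=> <-; apply: ae_eq_integral => //.
- apply/measurable_EFinP; apply: measurable_funM => //; exact: measurable_revr.
- exact: measurable_fubini_F (iK x).
have := ae_integrable1 (iK x); move: fE; apply: filterS2 => tau ftau iKtau _.
have [xtau|taux] := leP x tau.
  rewrite causal_le0 ?subr_le0// mul0r; apply/esym/integral0_eq => t _.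
  by rewrite /K /= causal_le0 ?subr_le0// mul0r.
pose y t : \bar R := (S1 (tau - t) * phib t)%:E.
(* Positivity of E_1 lets it be divided out of the integrable section of K, leaving integrability of
   S(tau-t) phi(t) in t. *)
have e0 : 0 < E1 (x - tau) by rewrite causal_expint1_gt0// subr_gt0.
have iy : mu.-integrable [set: R] y.
  have := integrableZl measurableT (E1 (x - tau))^-1 iKtau.
  apply: eq_integrable => // t _; rewrite /K /= -EFinM mulKf//.
  by rewrite gt_eqF.
have -> : (\int[mu]_t (EFin \o K x) (tau, t) =
    (E1 (x - tau))%:E * \int[mu]_t y t)%E.
  by rewrite -integralZl//; apply: eq_integral => t _; rewrite -EFinM.
have [taua|atau] := ltP tau a.
  rewrite patchE ifF; last by rewrite mem_setE in_itv/= leNgt taua.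
  rewrite mulr0 integral0_eq ?mule0// => t _; rewrite /y.
  have [ta|at_] := ltP t a.
    by rewrite patchE ifF ?mulr0// mem_setE in_itv/= leNgt ta.
  by rewrite causal_le0 ?mul0r// subr_le0 (le_trans (ltW taua)).
have tauab : tau \in `[a, b] by rewrite in_itv/= atau (le_trans (ltW taux)).
rewrite patchE ifT ?mem_setE// (ftau tauab) /frac_S Rintegral_causal//.
  by rewrite EFinM fineK//; exact: integrable_fin_num.
exact: le_trans (ltW taux) xb.
Qed.

End fractional_operators.

(** * Independence of the chosen representative, and conclusion *)

Section ac_representative_derivative.
Context {R : realType}.
Local Notation mu := (@lebesgue_measure R).

(** The representative is picked by choice, but continuity determines it on [a, b]; outside it is
    arbitrary. *)
Lemma the_ac_representativeE (a b : R) (u g : R -> R) : a < b ->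
  ac_representative a b u g ->
  forall x, a <= x <= b -> the_ac_representative a b u x = g x.
Proof.
move=> ab ug; have [acr ur] : ac_representative a b u (the_ac_representative a b u).
  exact: (xgetPex u (ex_intro _ g ug)).
case: ug => acg ug; apply: ae_eq_absolutely_continuous => //.
exact: ae_eq_trans (ae_eq_sym ur) ug.
Qed.

(** Restricted to the open interval, since the two-sided derivative at an endpoint sees the
    arbitrary values outside [a, b]. *)
Lemma derive1_the_ac_representative (a b : R) (u g : R -> R) : a < b ->
  ac_representative a b u g ->
  {in `]a, b[, derive1 (the_ac_representative a b u) =1 derive1 g}.
Proof.
move=> ab ug x xab; rewrite !derive1E; apply: near_eq_derive.
near=> y; apply: (the_ac_representativeE ab ug).
have : y \in `]a, b[ by near: y; exact: near_in_itvoo.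
by rewrite in_itv/= => /andP[/ltW -> /ltW ->].
Unshelve. all: by end_near. Qed.

Lemma ae_eq_itvcc (a b : R) (g h : R -> R) :
  {ae mu, forall x, x \in `]a, b[ -> g x = h x} -> ae_eq mu `[a, b]%classic g h.
Proof.
move=> gh; have : mu.-negligible [set a; b].
  exists [set a; b]; split => //; first exact: measurableU.
  by apply: countable_lebesgue_measure0; exact: finite_set_countable.
move=> nab; have ab0 : {ae mu, forall x, ~ [set a; b] x}.
  by apply: negligibleS nab => x /= /contrapT.
move: gh ab0; apply: filterS2 => [|x gh xab].
  exact: (ae_filter_ringOfSetsType mu).
rewrite /= in_itv/= => /andP[ax xb].
apply: gh; rewrite in_itv/= !lt_neqAle ax xb !andbT.
by apply/andP; split; apply/eqP => xE; apply: xab; [left|right].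
Qed.

Lemma ae_eq_L1 (a b : R) (g h : R -> R) : measurable_fun `[a, b] g ->
  ae_eq mu `[a, b]%classic g h -> L1 a b h -> L1 a b g.
Proof.
move=> mg gh /integrableP[mh hoo]; apply/integrableP; split.
  exact/measurable_EFinP.
apply: le_lt_trans hoo; rewrite le_eqVlt; apply/orP; left; apply/eqP.
apply: ae_eq_integral => //.
- by apply: measurableT_comp => //; exact/measurable_EFinP.
- exact: measurableT_comp.
- by apply: filterS gh => x gh xab; rewrite /= gh.
Qed.

End ac_representative_derivative.

(* The first two conjuncts say that the fractional derivative of f exists and
   is an admissible argument of frac_S. *)
Theorem theorem4p5 (R : realType) (alpha a b : R) (f : R -> R) :
  0 < alpha -> a < b -> in_frac_S_L1 a b alpha f ->
  [/\ has_ac_representative a b (frac_J a alpha f),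
      L1 a b (frac_deriv a b alpha f)
    & ae_eq (@lebesgue_measure R) `[a, b]%classic
        (frac_S a alpha (frac_deriv a b alpha f)) f].
Proof.
move=> alpha0 ab [iL1f [phi iphi fE]].
pose phib := phi \_ `[a, b]; pose g := primitive phib.
have iphib : (@lebesgue_measure R).-integrable [set: R] (EFin \o phib).
  by rewrite -restrict_EFin; apply/(integrable_mkcond _ _).1.
have Jg : ac_representative a b (frac_J a alpha f) g.
  split; first exact: absolutely_continuous_primitive.
  apply: aeW => x; rewrite /= in_itv/= => xab.
  exact: (frac_JE alpha0 iphi iL1f fE xab).
set D := frac_deriv a b alpha f.
have Dg : {in `]a, b[, D =1 derive1 g} by exact: derive1_the_ac_representative.
have mD : measurable_fun `[a, b] D.
  (* Reduction to an interval without its endpoints, where D is not controlled. *)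
  apply: (@measurable_fun_itv_cc R a b false true).
  apply: (eq_measurable_fun (derive1 g)).
    by move=> x; rewrite inE/= => xab; rewrite Dg.
  exact: measurable_funTS (measurable_derive1 (continuous_primitive iphib)).
have Dphi : ae_eq (@lebesgue_measure R) `[a, b]%classic D phi.
  apply: ae_eq_itvcc; move: (ae_derive_primitive iphib).
  apply: filterS => [|x [_ dx] xab].
    exact: (ae_filter_ringOfSetsType (@lebesgue_measure R)).
  rewrite Dg// dx /phib patchE ifT// mem_setE.
  exact: subset_itv_oo_cc xab.
have iD : L1 a b D by exact: ae_eq_L1 Dphi iphi.
split=> //; first by exists g.
apply: ae_eq_trans (ae_eq_sym fE); apply: aeW => x.
rewrite /= in_itv/= => /andP[_ xb].
have mS := measurable_causal_sonine alpha0.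
have mphib : measurable_fun [set: R] phib.
  by apply/measurable_EFinP; exact: measurable_int iphib.
have mDb : measurable_fun [set: R] (D \_ `[a, b]).
  by apply/(measurable_restrictT _ _).1.
have mrev (q : R -> R) : measurable_fun [set: R] q ->
    measurable_fun [set: R] (fun t => (causal sonine_kernel alpha (x - t) * q t)%:E).
  move=> mq; apply/measurable_EFinP; apply: measurable_funM; last exact: mq.
  by apply: (measurableT_comp mS); exact: measurable_funB.
(* At each x the integral depends only on the almost-everywhere class of the argument, so D may be
   replaced by phi. *)
rewrite /frac_S !(@Rintegral_causal R alpha a b)//; congr fine.
apply: ae_eq_integral => //; [exact: mrev|exact: mrev|].
move: Dphi; apply: filterS => t Dphi _; congr (_ * _)%:E.
by rewrite !patchE; case: ifPn => //; rewrite mem_setE => /Dphi.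
Qed.
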